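(* Let $M\ge 1$ be an integer, $\alpha,\beta,\omega,A_0,h_l,\bar\gamma,\mathcal R_t>0$ and $c=\frac{e}{2\pi}$. Let the SNRs $\gamma_1,\dots,\gamma_M$ of the $M$ HARQ rounds be independent, each with density $$f_{\gamma}(x)=\frac{\sqrt{\omega}}{2x\,\Gamma(\alpha)\Gamma(\beta)}\,G^{3,0}_{1,3}\!\left(\frac{\alpha\beta}{A_0h_l}\sqrt{\frac{x}{\bar\gamma}}\,\middle|\,\begin{matrix}\omega+\tfrac12\\ \alpha,\ \beta,\ \omega\end{matrix}\right),\qquad x>0 .$$ Then the outage probability of HARQ with Chase combining, $$P^{\mathrm{cc}}_{o,M}(\mathcal R_t)=\mathbb P\!\left(\tfrac12\log_2\!\Big(1+c\sum_{m=1}^M\gamma_m\Big)<\mathcal R_t\right)=\mathbb P\!\left(\sum_{m=1}^M\gamma_m\le\frac{2^{2\mathcal R_t}-1}{c}\right),$$ equals $$P^{\mathrm{cc}}_{o,M}(\mathcal R_t)=\left(\frac{\sqrt{\omega}}{2\Gamma(\alpha)\Gamma(\beta)}\right)^{M} H^{0,0;\,3,1;\dots;\,3,1}_{0,1;\,2,3;\dots;\,2,3}\!\left[u,\dots,u\,\middle|\,\begin{matrix}-\\ (0;\tfrac12,\dots,\tfrac12)\end{matrix}\,\middle|\,\begin{matrix}\{(1,\tfrac12),(\tfrac12+\omega,1)\}_1^M\\ \{(\alpha,1),(\beta,1),(\omega,1)\}_1^M\end{matrix}\right],$$ where $u=\frac{\alpha\beta}{A_0h_l}\sqrt{\frac{2^{2\mathcal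 R_t}-1}{c\bar\gamma}}$ is repeated $M$ times and $H$ is the $M$-variate Fox $H$-function.
   Context: Meijer $G$: $G^{3,0}_{1,3}\!\left(x\,\middle|\,\begin{matrix}a\\ b_1,b_2,b_3\end{matrix}\right)=\frac1{2\pi i}\int_L\frac{\Gamma(b_1-s)\Gamma(b_2-s)\Gamma(b_3-s)}{\Gamma(a-s)}x^s\,ds$ with $L$ an upward vertical line to the left of all poles of the numerator. The $M$-variate Fox $H$-function appearing in the claim is, by definition, for $u_1,\dots,u_M>0$, $$H[u_1,\dots,u_M]=\frac{1}{(2\pi i)^M}\int_{L_1}\!\!\cdots\int_{L_M}\frac{1}{\Gamma\!\left(1+\frac12\sum_{m=1}^M s_m\right)}\prod_{m=1}^M\frac{\Gamma(\alpha-s_m)\Gamma(\beta-s_m)\Gamma(\omega-s_m)\Gamma\!\left(\frac{s_m}{2}\right)}{\Gamma\!\left(\omega+\frac12-s_m\right)}u_m^{s_m}\,ds_1\cdots ds_M,$$ with $L_m$ an upward vertical line with $0<\operatorname{Re}s_m<\min(\alpha,\beta,\omega)$. The function $f_\gamma$ is an approximate density used as if exact (it is nonnegative but need not integrate exactly to $1$); accordingly, $\mathbb P((\gamma_1,\dots,\gamma_M)\in B)$ denotes $\int_B\prod_{m=1}^M f_\gamma(x_m)\,dx_1\cdots dx_M$ for Borel $B\subseteq(0,\infty)^M$. *)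

(* Defs.v *)
From HB Require Import structures.
From mathcomp Require Import all_boot all_order all_algebra.
From mathcomp Require Import complex.
From mathcomp Require Import all_classical all_reals all_analysis.

Set Implicit Arguments.
Unset Strict Implicit.
Unset Printing Implicit Defensive.

Import Order.TTheory GRing.Theory Num.Theory.
Import numFieldNormedType.Exports.

Local Open Scope classical_set_scope.
Local Open Scope ring_scope.
Local Open Scope complex_scope.

Section LebesgueTuple.
Context {R : realType}.

Definition cons_pair n (p : measurableTypeR R * n.-tuple (measurableTypeR R)) :
  n.+1.-tuple (measurableTypeR R) := [tuple of p.1 :: p.2].

Lemma measurable_cons_pair n : measurable_fun [set: _] (@cons_pair n).
Proof. exact: measurable_cons. Qed.

HB.instance Definition _ n :=
  isMeasurableFun.Build _ _ _ _ (@cons_pair n) (@measurable_cons_pair n).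

Section step.
Variables (n : nat)
  (mu : {sigma_finite_measure set (n.-tuple (measurableTypeR R)) -> \bar R}).

Definition lebesgue_cons : set (n.+1.-tuple (measurableTypeR R)) -> \bar R :=
  pushforward (lebesgue_measure \x mu)%E (@cons_pair n).

Let lebesgue_cons0 : lebesgue_cons set0 = 0%E.
Proof. exact: measure0. Qed.

Let lebesgue_cons_ge0 A : (0 <= lebesgue_cons A)%E.
Proof. exact: measure_ge0. Qed.

Let lebesgue_cons_sigma_additive : semi_sigma_additive lebesgue_cons.
Proof. exact: measure_semi_sigma_additive. Qed.

HB.instance Definition _ := isMeasure.Build _ _ _ lebesgue_cons
  lebesgue_cons0 lebesgue_cons_ge0 lebesgue_cons_sigma_additive.

Let lebesgue_cons_sigma_finite : sigma_finite setT lebesgue_cons.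
Proof.
have /sigma_finiteP[F [FT ndF Fm]] := sigma_finiteT (@lebesgue_measure R).
have /sigma_finiteP[G [GT ndG Gm]] := sigma_finiteT mu.
pose uncons (t : n.+1.-tuple (measurableTypeR R)) :
  (measurableTypeR R * n.-tuple (measurableTypeR R))%type :=
  (thead t, [tuple of behead t]).
have munc : measurable_fun setT uncons.
  apply: measurable_fun_pair; last exact: measurable_behead.
  exact: measurable_tnth.
have consK : cancel (@cons_pair n) uncons.
  by move=> [x t]; congr pair; exact/val_inj.
exists (fun i => uncons @^-1` (F i `*` G i)).
  apply/esym; rewrite -subTset => t _.
  have [i _ Fi] : (\bigcup_i F i) (uncons t).1 by rewrite -FT.
  have [j _ Gj] : (\bigcup_i G i) (uncons t).2 by rewrite -GT.
  exists (maxn i j) => //; split.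
  - by move: Fi; exact/subsetPset/ndF/leq_maxl.
  - by move: Gj; exact/subsetPset/ndG/leq_maxr.
move=> i; have [mFi Fioo] := Fm i; have [mGi Gioo] := Gm i; split.
  by rewrite -[X in measurable X]setTI; apply: munc => //; exact: measurableX.
rewrite /lebesgue_cons /pushforward -comp_preimage.
rewrite (_ : uncons \o _ = id); last exact/funext.
by rewrite preimage_id product_measure1E// lte_mul_pinfty// ge0_fin_numE.
Qed.

HB.instance Definition _ := Measure_isSigmaFinite.Build _ _ _ lebesgue_cons
  lebesgue_cons_sigma_finite.

End step.

(* Lebesgue measure on R^n, as the n-fold product of lebesgue_measure. *)
Fixpoint lebesgue_tuple n :
    {sigma_finite_measure set (n.-tuple (measurableTypeR R)) -> \bar R} :=
  if n is n'.+1 then lebesgue_cons (lebesgue_tuple n')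
  else \d_([tuple] : 0.-tuple (measurableTypeR R)).

Lemma lebesgue_tuple_box n (A : 'I_n -> set (measurableTypeR R)) :
  (forall i, measurable (A i)) ->
  lebesgue_tuple n [set t | forall i, A i (tnth t i)] =
  (\prod_(i < n) lebesgue_measure (A i))%E.
Proof.
elim: n A => [|n IHn] A mA.
  rewrite big_ord0 /= diracE mem_set//; by case.
rewrite big_ord_recl /= /lebesgue_cons /pushforward.
rewrite (_ : _ @^-1` _ =
  A ord0 `*` [set t : n.-tuple _ | forall i, A (lift ord0 i) (tnth t i)]).
  rewrite product_measure1E//=; first by rewrite (IHn (fun i => A (lift ord0 i))).
  rewrite (_ : [set t | _] =
    \bigcap_(i in [set: 'I_n]) ((fun t => tnth t i) @^-1` A (lift ord0 i))).
    apply: fin_bigcap_measurable => // i _.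
    by rewrite -[X in measurable X]setTI; exact: measurable_tnth.
  by apply/seteqP; split=> t /= tA i => [_|]; exact: tA.
apply/seteqP; split => -[x t] /=.
  move=> xtA; split; first exact: (xtA ord0).
  by move=> i; have := xtA (lift ord0 i); rewrite tnthS.
move=> [xA tA] i; case: (unliftP ord0 i) => [j ->|->//].
by rewrite tnthS.
Qed.

End LebesgueTuple.

Section SpecialFunctions.
Context {R : realType}.

Definition cintegral d (T : measurableType d) (mu : {measure set T -> \bar R})
    (D : set T) (F : T -> R[i]) : R[i] :=
  (\int[mu]_(x in D) complex.Re (F x)) +i* (\int[mu]_(x in D) complex.Im (F x)).

(* Meaningful only for 0 < x. *)
Definition cpow (x : R) (s : R[i]) : R[i] :=
  (expR (complex.Re s * ln x))%:C *
  (cos (complex.Im s * ln x) +i* sin (complex.Im s * ln x)).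

Definition euler_Gamma (z : R[i]) : R[i] :=
  cintegral lebesgue_measure `]0, +oo[
    (fun t : R => cpow t (z - 1) * (expR (- t))%:C).

(* The Gamma function on the whole plane: Euler's integral when Re z > 0, and
   otherwise Gamma (z + n) / (z (z + 1) ... (z + n - 1)) for an n such that
   Re z + n > 0. Since 0^-1 = 0, the value of Gamma and of 1 / Gamma at the
   poles 0, -1, -2, ... is 0. *)
Definition Gamma (z : R[i]) : R[i] :=
  let n := if 0 < complex.Re z then 0%N
           else (Num.truncn (- complex.Re z)).+1 in
  euler_Gamma (z + n%:R) / \prod_(k < n) (z + k%:R).

(* The integral of F ds_1 ... ds_M, each s_m running upward along the vertical
   line Re s_m = sigma m: with s_m = sigma m + i t_m, ds_m = i dt_m. *)
Definition vlines_integral M (sigma : 'I_M -> R) (F : ('I_M -> R[i]) -> R[i]) :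
    R[i] :=
  'i%C ^+ M * cintegral (lebesgue_tuple M) setT
    (fun t : M.-tuple (measurableTypeR R) =>
       F (fun m => sigma m +i* (tnth t m : R))).

Definition vline_integral (sigma : R) (F : R[i] -> R[i]) : R[i] :=
  'i%C * cintegral lebesgue_measure setT (fun t : R => F (sigma +i* t)).

Definition twopii : R[i] := (2 * pi)%:C * 'i%C.

(* Meijer's G^{3,0}_{1,3}(x | a ; b1, b2, b3), integrated along the line
   Re s = sigma, which should satisfy sigma < b1, b2, b3. *)
Definition meijerG3013 (sigma a b1 b2 b3 x : R) : R[i] :=
  twopii^-1 * vline_integral sigma (fun s =>
    Gamma (b1%:C - s) * Gamma (b2%:C - s) * Gamma (b3%:C - s)
      / Gamma (a%:C - s) * cpow x s).

(* The M-variate Fox H-function with the lower parameter (0; 1/2, ..., 1/2) in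
   the joint block and, for each variable, the upper parameters
   (1, 1/2), (1/2 + omega, 1) and the lower ones
   (alpha, 1), (beta, 1), (omega, 1), integrated along the lines
   Re s_m = sigma m, which should satisfy 0 < sigma m < alpha, beta, omega. *)
Definition foxH M (sigma : 'I_M -> R) (alpha beta omega : R) (u : 'I_M -> R) :
    R[i] :=
  (twopii ^+ M)^-1 * vlines_integral sigma (fun s =>
    (Gamma (1 + 2^-1 * \sum_(m < M) s m))^-1 *
    \prod_(m < M)
      (Gamma (alpha%:C - s m) * Gamma (beta%:C - s m) * Gamma (omega%:C - s m)
       * Gamma (s m / 2) / Gamma (omega%:C + 2^-1 - s m) * cpow (u m) (s m))).

End SpecialFunctions.

Section Channel.
Context {R : realType}.

(* The argument of Re is real: on a vertical line, conjugating s conjugates the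
   integrand of G. *)
Definition snr_density (sigma alpha beta omega A0 hl gbar x : R) : R :=
  complex.Re
    ((Num.sqrt omega)%:C / ((2 * x)%:C * Gamma alpha%:C * Gamma beta%:C) *
     meijerG3013 sigma (omega + 2^-1) alpha beta omega
       (alpha * beta / (A0 * hl) * Num.sqrt (x / gbar))).

Definition positive_orthant M : set (M.-tuple (measurableTypeR R)) :=
  [set x | forall m, 0 < (tnth x m : R)].

(* P((gamma_1, ..., gamma_M) \in B) for independent gamma_m of density f on
   (0, +oo); f is not required to integrate to 1. *)
Definition joint_prob M (f : R -> R) (B : set (M.-tuple (measurableTypeR R))) :
    \bar R :=
  (\int[lebesgue_tuple M]_(x in @positive_orthant M `&` B)
     (\prod_(m < M) f (tnth x m))%R%:E)%E.

Definition log2 (x : R) : R := ln x / ln 2.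

End Channel.

(* Main.v *)
Require Import Defs.
From HB Require Import structures.
From mathcomp Require Import all_boot all_order all_algebra.
From mathcomp Require Import complex.
From mathcomp Require Import all_classical all_reals all_analysis.
From mathcomp Require Import measurable_realfun ring lra.

(** Unfold [1 / 2 pi i] times the contour integrals: the density is
    [c / x] times a Mellin-Barnes integral of
    [Phi s = Gamma (alpha - s) Gamma (beta - s) Gamma (omega - s) / Gamma (omega + 1/2 - s)],
    and integrating [\prod_m x_m ^ (s_m / 2 - 1)] over the simplex
    [\sum_m x_m <= r] gives, by Dirichlet's formula,
    [r ^ (\sum_m s_m / 2) \prod_m Gamma (s_m / 2) / Gamma (1 + \sum_m s_m / 2)].
    Exchanging the two integrals yields the Fox H-function.  Two points need care.

    Convergence: since [Gamma (z + 2) = z (z + 1) Gamma z] and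
    [|Gamma z| <= Gamma (Re z)], [Gamma] decays quadratically on vertical lines;
    the other factors of [Phi] are bounded, the quotient being
    [Gamma (omega - s) / Gamma (omega + 1/2 - s) = Beta (omega - s, 1/2) / Gamma (1/2)].
    So [Phi] is absolutely integrable on every admissible line and Fubini applies.

    Independence of the contour is obtained without complex analysis: up to a
    constant, [Phi] is the Laplace transform [s |-> \int rho e^(- s L)] of a positive
    weight.  With the Fejer summation kernel [K_N], the inverse transform along
    [Re s = a] is the limit of [\int rho e^(a (v - L)) K_N (v - L)], which is real.
    As [|K_N u| <= 2 / |u|], [K_N u -> 0] for [u <> 0] and
    [|e^(a u) - e^(b u)| <= |a - b| |u| (e^(a u) + e^(b u))], dominated convergence
    shows that the limits for [a] and [b] agree. *)

Set Implicit Arguments.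
Unset Strict Implicit.
Unset Printing Implicit Defensive.

Import Order.TTheory GRing.Theory Num.Theory.
Import numFieldNormedType.Exports.
Import ComplexField.

Local Open Scope classical_set_scope.
Local Open Scope ring_scope.
Local Open Scope complex_scope.

Local Notation cnorm := Normc.normc.
Local Notation RE := complex.Re.
Local Notation IM := complex.Im.

(** * Complex-valued integrals *)

(** The density may be given on any line [Re s = sigmaG] to the left of the poles, even a negative
    one, while [x ^ (s / 2 - 1)] is integrable near 0 only for [0 < Re s], and [foxH] may use a
    different line for each variable. So the contour must be moved before the integrals are
    exchanged. The same argument shows that the contour integral is real, hence that the real part
    in [snr_density] loses nothing.

    [Phi] is a Laplace transform because each of its factors integrates a positive weight against
    [y ^ (- s) = e ^ (- s ln y)]; a product of three such integrals is one integral over triples,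
    with [L] the sum of the logarithms.

    Gamma is inverted in [Phi] and in Dirichlet's formula, and the inverse of 0 is 0, so the Beta
    relation can be divided only once Gamma is known to have no zero in [0 < Re z]. The functional
    equation would carry a zero to the right along [z + n], into a region where a concentration
    estimate excludes it.

    Powers are not integrable on the whole orthant. On the simplex, however, [1 <= e ^ (r - sum x)],
    which turns them into Gamma integrands and gives a majorant independent of the heights on the
    lines. *)

Section RealFubini.
Context d1 d2 (T1 : measurableType d1) (T2 : measurableType d2) (R : realType).
Variables (m1 : {sigma_finite_measure set T1 -> \bar R})
  (m2 : {sigma_finite_measure set T2 -> \bar R}).
Local Open Scope ereal_scope.

(** The inner integral may fail to be finite on a null set, where [fine] replaces it by a default
    value; elsewhere the real and the extended integrands agree. *)
Lemma Rintegral_fubini1 (f : T1 * T2 -> R) :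
  (m1 \x m2).-integrable setT (EFin \o f) ->
  (\int[m1]_x \int[m2]_y f (x, y) = \int[m1 \x m2]_z f z)%R.
Proof.
move=> fi; rewrite /Rintegral; congr fine.
rewrite -(integral12_prod_meas1 fi).
have iF := integrable_fubini_F fi.
apply: ae_eq_integral => //.
- apply/measurable_EFinP/measurableT_comp => //.
  exact: (measurable_int m1 iF).
- exact: (measurable_int m1 iF).
have := integrable_ae measurableT iF.
apply: filterS => x /= /(_ I) h _.
by rewrite fineK.
Qed.

Lemma Rintegral_fubini2 (f : T1 * T2 -> R) :
  (m1 \x m2).-integrable setT (EFin \o f) ->
  (\int[m2]_y \int[m1]_x f (x, y) = \int[m1 \x m2]_z f z)%R.
Proof.
move=> fi; rewrite /Rintegral; congr fine.
rewrite -(integral21_prod_meas1 fi).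
apply: ae_eq_integral => //.
- apply/measurable_EFinP/measurableT_comp => //.
  exact: measurable_fubini_G fi.
- exact: measurable_fubini_G fi.
have := ae_integrable2 fi.
apply: filterS => y h _.
by rewrite fineK//; exact: (integrable_fin_num measurableT h).
Qed.

Lemma integrable_prod_fun (f : T1 -> R) (g : T2 -> R) :
  m1.-integrable setT (EFin \o f) -> m2.-integrable setT (EFin \o g) ->
  (m1 \x m2).-integrable setT (EFin \o (fun z => f z.1 * g z.2)%R).
Proof.
move=> fi gi.
have mf : measurable_fun setT f by apply/measurable_EFinP; exact: (measurable_int m1 fi).
have mg : measurable_fun setT g by apply/measurable_EFinP; exact: (measurable_int m2 gi).
apply/integrable12ltyP.
  apply/measurable_EFinP/measurable_funM.
  - by apply: (measurableT_comp mf); exact: measurable_fst.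
  - by apply: (measurableT_comp mg); exact: measurable_snd.
have mag : measurable_fun setT (fun y => `|g y|%:E).
  exact/measurable_EFinP/measurableT_comp.
have iag : \int[m2]_y `|g y|%:E \is a fin_num.
  exact: (integrable_fin_num measurableT (integrable_norm gi)).
rewrite (eq_integral (fun x => (\int[m2]_y `|g y|%:E) * `|f x|%:E)).
  rewrite -(fineK iag) ge0_integralZl_EFin//.
  - rewrite lte_mul_pinfty ?lee_fin ?fine_ge0 ?integral_ge0//.
    rewrite ltey_eq; apply/orP; left.
    exact: (integrable_fin_num measurableT (integrable_norm fi)).
  - exact/measurable_EFinP/measurableT_comp.
  - by rewrite fine_ge0// integral_ge0.
move=> x _.
rewrite (eq_integral (fun y => `|f x|%:E * `|g y|%:E)).
  by rewrite ge0_integralZl_EFin// muleC.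
by move=> y _; rewrite /= normrM EFinM.
Qed.

End RealFubini.

Section ComplexIntegral.
Context {R : realType}.
Local Notation C := R[i].

Lemma normc_Re (z : C) : `|RE z| <= cnorm z.
Proof.
case: z => a b /=; rewrite -(sqrtr_sqr a); apply: ler_wsqrtr.
by rewrite lerDl sqr_ge0.
Qed.

Lemma normc_Im (z : C) : `|IM z| <= cnorm z.
Proof.
case: z => a b /=; rewrite -(sqrtr_sqr b); apply: ler_wsqrtr.
by rewrite lerDr sqr_ge0.
Qed.

Lemma normc_le_ReIm (z : C) : cnorm z <= `|RE z| + `|IM z|.
Proof.
case: z => a b /=.
rewrite -(ger0_norm (addr_ge0 (normr_ge0 a) (normr_ge0 b))) -sqrtr_sqr.
apply: ler_wsqrtr; rewrite sqrrD !real_normK ?num_real//.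
rewrite addrAC lerDl.
by rewrite mulrn_wge0// mulr_ge0.
Qed.

Lemma normc_ge0 (z : C) : 0 <= cnorm z.
Proof. exact: le_trans (normr_ge0 _) (normc_Re z). Qed.

Lemma normc_real (x : R) : cnorm x%:C = `|x|.
Proof. by rewrite /= expr0n/= addr0 sqrtr_sqr. Qed.

Lemma normc_prod (I : Type) (r : seq I) (F : I -> C) :
  cnorm (\prod_(i <- r) F i) = \prod_(i <- r) cnorm (F i).
Proof. by rewrite (big_morph _ (@Normc.normcM R) (Normc.normc1 R)). Qed.

Section measurability.
Context d (T : measurableType d).
Implicit Types F G : T -> C.

Definition cmeasurable F :=
  measurable_fun setT (fun x => RE (F x)) /\
  measurable_fun setT (fun x => IM (F x)).

Lemma cmeasurable_real (f : T -> R) :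
  measurable_fun setT f -> cmeasurable (fun x => (f x)%:C).
Proof. by move=> mf; split=> //=; exact: measurable_cst. Qed.

Lemma cmeasurable_cst (c : C) : cmeasurable (fun=> c).
Proof. by split; exact: measurable_cst. Qed.

Lemma cmeasurableD F G :
  cmeasurable F -> cmeasurable G -> cmeasurable (fun x => F x + G x).
Proof.
move=> [F1 F2] [G1 G2]; split.
- rewrite (_ : (fun _ => _) = (fun x => RE (F x)) \+ (fun x => RE (G x))).
    exact: measurable_funD.
  by apply/funext => x /=; case: (F x) => ? ?; case: (G x).
- rewrite (_ : (fun _ => _) = (fun x => IM (F x)) \+ (fun x => IM (G x))).
    exact: measurable_funD.
  by apply/funext => x /=; case: (F x) => ? ?; case: (G x).
Qed.

Lemma cmeasurableM F G :
  cmeasurable F -> cmeasurable G -> cmeasurable (fun x => F x * G x).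
Proof.
move=> [F1 F2] [G1 G2]; split.
- rewrite (_ : (fun _ => _) = (fun x => RE (F x) * RE (G x))
     \- (fun x => IM (F x) * IM (G x))).
    by apply: measurable_funB; exact: measurable_funM.
  by apply/funext => x /=; case: (F x) => ? ?; case: (G x).
- rewrite (_ : (fun _ => _) = (fun x => RE (F x) * IM (G x))
     \+ (fun x => IM (F x) * RE (G x))).
    by apply: measurable_funD; exact: measurable_funM.
  by apply/funext => x /=; case: (F x) => ? ?; case: (G x).
Qed.

Lemma cmeasurable_prod (I : Type) (r : seq I) (F : I -> T -> C) :
  (forall i, cmeasurable (F i)) -> cmeasurable (fun x => \prod_(i <- r) F i x).
Proof.
move=> mF; elim: r => [|i r IH].
  by under eq_fun do rewrite big_nil; exact: cmeasurable_cst.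
by under eq_fun do rewrite big_cons; exact: cmeasurableM.
Qed.

Lemma measurable_normc F : cmeasurable F -> measurable_fun setT (fun x => cnorm (F x)).
Proof.
move=> [F1 F2].
rewrite (_ : (fun _ => _) =
    (@Num.sqrt R) \o (fun x => RE (F x) ^+ 2 + IM (F x) ^+ 2)).
  apply: measurableT_comp.
    by apply: continuous_measurable_fun; exact: sqrt_continuous.
  by apply: measurable_funD; exact: measurable_funX.
by apply/funext => x /=; case: (F x).
Qed.

End measurability.

Lemma cmeasurable_comp d1 d2 (T1 : measurableType d1) (T2 : measurableType d2)
    (F : T2 -> C) (h : T1 -> T2) :
  cmeasurable F -> measurable_fun setT h -> cmeasurable (fun x => F (h x)).
Proof. by move=> [F1 F2] mh; split; [move: F1|move: F2] => mF; exact: (measurableT_comp mF mh). Qed.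

Section integrability.
Context d (T : measurableType d) (mu : {measure set T -> \bar R}).
Implicit Types F G : T -> C.

Definition cintegrable F :=
  mu.-integrable setT (EFin \o (fun x => RE (F x))) /\
  mu.-integrable setT (EFin \o (fun x => IM (F x))).

Local Notation cint F := (cintegral mu setT F).

Lemma cintegrable_cmeasurable F : cintegrable F -> cmeasurable F.
Proof.
by move=> [F1 F2]; split; apply/measurable_EFinP;
  [exact: (measurable_int mu F1)|exact: (measurable_int mu F2)].
Qed.

Lemma le_cintegrable F (g : T -> R) : cmeasurable F ->
  (forall x, cnorm (F x) <= g x) -> mu.-integrable setT (EFin \o g) ->
  cintegrable F.
Proof.
move=> [F1 F2] Fg gi; split; apply: le_integrable gi => //.
- exact/measurable_EFinP.
- move=> x _ /=; rewrite lee_fin (le_trans _ (ler_norm _))//.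
  exact: le_trans (normc_Re _) (Fg x).
- exact/measurable_EFinP.
- move=> x _ /=; rewrite lee_fin (le_trans _ (ler_norm _))//.
  exact: le_trans (normc_Im _) (Fg x).
Qed.

Lemma integrable_normc F :
  cintegrable F -> mu.-integrable setT (EFin \o (fun x => cnorm (F x))).
Proof.
move=> iF; have [F1 F2] := iF.
have := integrableD measurableT (integrable_norm F1) (integrable_norm F2).
apply: le_integrable => //.
  by apply/measurable_EFinP/measurable_normc/cintegrable_cmeasurable.
move=> x _ /=; rewrite lee_fin ger0_norm ?normc_ge0// ger0_norm ?addr_ge0//.
exact: normc_le_ReIm.
Qed.

Lemma cintegral_real (f : T -> R) :
  cint (fun x => (f x)%:C) = (\int[mu]_x f x)%:C.
Proof.
rewrite /cintegral /=; congr (_ +i* _).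
by rewrite /Rintegral /= integral0.
Qed.

Lemma eq_cintegral F G : F =1 G -> cint F = cint G.
Proof. by move=> FG; congr (cintegral _ _); exact/funext. Qed.

Lemma cintegralD F G : cintegrable F -> cintegrable G ->
  cint (fun x => F x + G x) = cint F + cint G.
Proof.
move=> [F1 F2] [G1 G2]; rewrite /cintegral; congr (_ +i* _).
- rewrite -RintegralD//; apply: eq_Rintegral => x _ /=.
  by case: (F x) => ? ?; case: (G x).
- rewrite -RintegralD//; apply: eq_Rintegral => x _ /=.
  by case: (F x) => ? ?; case: (G x).
Qed.

Lemma cintegrableZ (c : C) F : cintegrable F -> cintegrable (fun x => c * F x).
Proof.
move=> iF; apply: (@le_cintegrable _ (fun x => cnorm c * cnorm (F x))).
- apply: cmeasurableM; first exact: cmeasurable_cst.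
  exact: cintegrable_cmeasurable.
- by move=> x; rewrite Normc.normcM.
- exact: (integrableZl measurableT _ (integrable_normc iF)).
Qed.

Lemma cintegralZ (c : C) F : cintegrable F ->
  cint (fun x => c * F x) = c * cint F.
Proof.
move=> [F1 F2]; rewrite /cintegral; case: c => a b /=; congr (_ +i* _).
- rewrite -!RintegralZl// -RintegralB//.
  + by apply: eq_Rintegral => x _ /=; case: (F x).
  + exact: (integrableZl measurableT _ F1).
  + exact: (integrableZl measurableT _ F2).
- rewrite -!RintegralZl// -RintegralD//.
  + by apply: eq_Rintegral => x _ /=; case: (F x).
  + exact: (integrableZl measurableT _ F2).
  + exact: (integrableZl measurableT _ F1).
Qed.

Lemma cintegral_mkcond (D : set T) F :
  cintegral mu D F = cint (fun x => (\1_D x)%:C * F x).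
Proof.
rewrite /cintegral; congr (_ +i* _); rewrite Rintegral_mkcond;
  apply: eq_Rintegral => x _; rewrite patchE indicE.
- by case: ifPn => _; case: (F x) => ? ? /=; rewrite ?mul1r !mul0r subr0.
- by case: ifPn => _; case: (F x) => ? ? /=; rewrite ?mul1r !mul0r addr0.
Qed.

(** With [I] the integral, multiplying by the conjugate of [I] rotates it onto the real axis:
    [|I|^2] is the integral of the real part of [I^* F], which is at most [|I| |F|]. Then divide by
    [|I|]. *)
Lemma le_normc_cintegral F : cintegrable F ->
  cnorm (cint F) <= \int[mu]_x cnorm (F x).
Proof.
move=> iF; have [->|z0] := eqVneq (cint F) 0.
  rewrite Normc.normc0 Rintegral_ge0// => x _; exact: normc_ge0.
have nz0 : 0 < cnorm (cint F).
  rewrite lt_neqAle normc_ge0 andbT eq_sym; apply: contra z0.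
  by move=> /eqP/Normc.eq0_normc ->.
have cE : cint F = RE (cint F) +i* IM (cint F) by case: (cint F).
rewrite -(ler_pM2l nz0).
have -> : cnorm (cint F) * cnorm (cint F) = RE ((cint F)^* * cint F).
  move: (cint F) => [a b] /=; rewrite -expr2 sqr_sqrtr ?addr_ge0 ?sqr_ge0//.
  by rewrite mulNr opprK !expr2.
rewrite -cintegralZ// -RintegralZl//; last exact: integrable_normc.
have [iR _] := cintegrableZ ((cint F)^*) iF.
rewrite /cintegral /=; apply: le_Rintegral => //.
  exact: (integrableZl measurableT _ (integrable_normc iF)).
move=> x _; apply: le_trans (ler_norm _) _; apply: le_trans (normc_Re _) _.
rewrite Normc.normcM ler_wpM2r ?normc_ge0//.
by move: (\int[mu]_(x in _) _) (\int[mu]_(x in _) _) => a b /=; rewrite sqrrN.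
Qed.

End integrability.

Section fubini.
Context d1 d2 (T1 : measurableType d1) (T2 : measurableType d2).
Variables (m1 : {sigma_finite_measure set T1 -> \bar R})
  (m2 : {sigma_finite_measure set T2 -> \bar R}).

Lemma cintegral_fubini1 (F : T1 * T2 -> C) : cintegrable (m1 \x m2)%E F ->
  cintegral m1 setT (fun x => cintegral m2 setT (fun y => F (x, y))) =
  cintegral (m1 \x m2)%E setT F.
Proof.
move=> [F1 F2]; rewrite /cintegral /=; congr (_ +i* _).
- exact: (Rintegral_fubini1 F1).
- exact: (Rintegral_fubini1 F2).
Qed.

Lemma cintegral_fubini2 (F : T1 * T2 -> C) : cintegrable (m1 \x m2)%E F ->
  cintegral m2 setT (fun y => cintegral m1 setT (fun x => F (x, y))) =
  cintegral (m1 \x m2)%E setT F.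
Proof.
move=> [F1 F2]; rewrite /cintegral /=; congr (_ +i* _).
- exact: (Rintegral_fubini2 F1).
- exact: (Rintegral_fubini2 F2).
Qed.

Lemma cintegrable_prod_fun (F : T1 -> C) (G : T2 -> C) :
  cintegrable m1 F -> cintegrable m2 G ->
  cintegrable (m1 \x m2)%E (fun z => F z.1 * G z.2).
Proof.
move=> iF iG.
apply: (@le_cintegrable _ _ _ _ (fun z => cnorm (F z.1) * cnorm (G z.2))).
- apply: cmeasurableM.
  + by apply: cmeasurable_comp; [exact: cintegrable_cmeasurable iF|exact: measurable_fst].
  + by apply: cmeasurable_comp; [exact: cintegrable_cmeasurable iG|exact: measurable_snd].
- by move=> z; rewrite Normc.normcM.
- exact: (integrable_prod_fun (integrable_normc iF) (integrable_normc iG)).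
Qed.

Lemma cintegral_prod_fun (F : T1 -> C) (G : T2 -> C) :
  cintegrable m1 F -> cintegrable m2 G ->
  cintegral (m1 \x m2)%E setT (fun z => F z.1 * G z.2) =
  cintegral m1 setT F * cintegral m2 setT G.
Proof.
move=> iF iG; rewrite -cintegral_fubini1; last exact: cintegrable_prod_fun.
rewrite mulrC -cintegralZ//; apply: eq_cintegral => x /=.
by rewrite cintegralZ// mulrC.
Qed.

End fubini.

End ComplexIntegral.

(** * Complex exponentials and complex powers of real numbers *)

Section ComplexExponential.
Context {R : realType}.
Local Notation C := R[i].

Definition cexp (z : C) : C := (expR (RE z))%:C * (cos (IM z) +i* sin (IM z)).

Lemma cexpD (z w : C) : cexp (z + w) = cexp z * cexp w.
Proof.
case: z w => [a b] [c d]; rewrite /cexp /= expRD cosD sinD.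
by apply/eqP; rewrite eq_complex /=; apply/andP; split; apply/eqP; ring.
Qed.

Lemma normc_cexp (z : C) : cnorm (cexp z) = expR (RE z).
Proof.
rewrite /cexp Normc.normcM normc_real /= cos2Dsin2 sqrtr1 mulr1.
by rewrite ger0_norm ?expR_ge0.
Qed.

Lemma cexp_real (x : R) : cexp x%:C = (expR x)%:C.
Proof.
by rewrite /cexp/= cos0 sin0; apply/eqP; rewrite eq_complex /= !mulr0 !mul0r
  mulr1 subr0 addr0 !eqxx.
Qed.

Lemma cpowE (x : R) (s : C) : cpow x s = cexp (s * (ln x)%:C).
Proof. by case: s => a b; rewrite /cpow /cexp /= !mulr0 subr0 add0r. Qed.

Lemma cpowD (x : R) (s t : C) : cpow x (s + t) = cpow x s * cpow x t.
Proof. by rewrite !cpowE mulrDl cexpD. Qed.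

Lemma cpowM (x y : R) (s : C) : 0 < x -> 0 < y ->
  cpow (x * y) s = cpow x s * cpow y s.
Proof. by move=> x0 y0; rewrite !cpowE lnM// rmorphD/= mulrDr cexpD. Qed.

Lemma normc_cpow (x : R) (s : C) : cnorm (cpow x s) = expR (RE s * ln x).
Proof. by rewrite cpowE normc_cexp; case: s => a b /=; rewrite mulr0 subr0. Qed.

Lemma cpow_real (x a : R) : cpow x a%:C = (expR (a * ln x))%:C.
Proof. by rewrite cpowE -rmorphM cexp_real. Qed.

Lemma cpow0 (x : R) : cpow x 0 = 1.
Proof. by rewrite (cpow_real x 0) mul0r expR0. Qed.

Lemma cpow_nat1 (x : R) : 0 < x -> cpow x 1 = x%:C.
Proof. by move=> x0; rewrite (cpow_real x 1) mul1r lnK. Qed.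

Lemma cpow1 (s : C) : cpow 1 s = 1.
Proof. by rewrite cpowE ln1 mulr0 (cexp_real 0) expR0. Qed.

Lemma cmeasurable_cexp d (T : measurableType d) (F : T -> C) :
  cmeasurable F -> cmeasurable (fun x => cexp (F x)).
Proof.
move=> [F1 F2]; apply: cmeasurableM.
  by apply: cmeasurable_real; apply: measurableT_comp => //; exact: measurable_expR.
by split => /=; apply: measurableT_comp => //;
  apply: continuous_measurable_fun; [exact: continuous_cos|exact: continuous_sin].
Qed.

Lemma cmeasurable_cpow d (T : measurableType d) (f : T -> R) (F : T -> C) :
  measurable_fun setT f -> cmeasurable F ->
  cmeasurable (fun x => cpow (f x) (F x)).
Proof.
move=> mf mF; under eq_fun do rewrite cpowE.
apply/cmeasurable_cexp/cmeasurableM => //; apply: cmeasurable_real.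
by apply: measurableT_comp => //; exact: measurable_ln.
Qed.

End ComplexExponential.

(** * Affine substitution and the fundamental theorem of calculus on the real line *)

Section LebesgueReal.
Context {R : realType}.
Local Notation C := R[i].
Local Notation mu := (@lebesgue_measure R).

Lemma measurable_affine (a b : R) :
  measurable_fun [set: measurableTypeR R] (fun x : measurableTypeR R => a * x + b : measurableTypeR R).
Proof. by apply: measurable_funD => //; exact: measurable_funM. Qed.

(** By uniqueness of Lebesgue measure it is enough to compare half-open intervals. For [a < 0] the
    preimage is half-open on the other side, which does not change its length. *)
Lemma lebesgue_measure_affine (a b : R) (a0 : a != 0) A : measurable A ->
  mu A = (`|a|%:E * pushforward mu (fun x : measurableTypeR R => (a * x + b)%R : measurableTypeR R) A)%E.
Proof.
move=> mA.
pose phi := (fun x : measurableTypeR R => a * x + b : measurableTypeR R).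
have mphi : measurable_fun setT phi := measurable_affine a b.
pose phi' : {mfun measurableTypeR R >-> measurableTypeR R} :=
  HB.pack phi (isMeasurableFun.Build _ _ _ _ phi mphi).
have an0 : 0 <= `|a| by [].
rewrite [LHS](@lebesgue_measure_unique R (mscale (NngNum an0) (pushforward mu phi')))//.
move=> _ [[c d] _ <-] /=.
rewrite /mscale/= /pushforward /phi /=.
have [ap|an] := ltP 0 a.
  rewrite (_ : _ @^-1` _ = [set` `](c - b) / a, (d - b) / a]]); last first.
    apply/seteqP; split => x /=; rewrite !in_itv/= ltr_pdivrMr// ler_pdivlMr//;
      by rewrite ltrBlDr lerBrDr mulrC.
  rewrite !lebesgue_measure_itv/= !lte_fin ltr_pM2r ?invr_gt0// ltrD2r.
  case: ifP => _; last by rewrite mule0.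
  by rewrite !EFinN -!EFinD -EFinM gtr0_norm//; congr EFin; field.
have {}an : a < 0 by rewrite lt_neqAle a0.
rewrite (_ : _ @^-1` _ = [set` `[(d - b) / a, (c - b) / a[]); last first.
  apply/seteqP; split => x /=; rewrite !in_itv/= ltr_ndivlMr// ler_ndivrMr//;
    by rewrite ltrBlDr lerBrDr mulrC andbC.
rewrite !lebesgue_measure_itv/= !lte_fin ltr_nM2r ?invr_lt0// ltrD2r.
case: ifP => _; last by rewrite mule0.
by rewrite !EFinN -!EFinD -EFinM ltr0_norm//; congr EFin; field.
Qed.

Lemma ge0_integral_affine (a b : R) (f : R -> \bar R) : a != 0 ->
  measurable_fun [set: measurableTypeR R] f -> (forall x, 0 <= f x)%E ->
  (\int[mu]_x f x = `|a|%:E * \int[mu]_x f (a * x + b)%R)%E.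
Proof.
move=> a0 mf f0.
pose phi := (fun x : measurableTypeR R => a * x + b : measurableTypeR R).
have mphi : measurable_fun setT phi := measurable_affine a b.
pose phi' : {mfun measurableTypeR R >-> measurableTypeR R} :=
  HB.pack phi (isMeasurableFun.Build _ _ _ _ phi mphi).
have an0 : 0 <= `|a| by [].
rewrite (eq_measure_integral (mscale (NngNum an0) (pushforward mu phi'))).
  rewrite ge0_integral_mscale//=.
  congr (_ * _)%E.
  have := @ge0_integral_pushforward _ _ _ _ R phi mphi mu setT f measurableT mf.
  by rewrite preimage_setT; apply => y _; exact: f0.
by move=> A mA _; exact: (lebesgue_measure_affine b a0 mA).
Qed.

Lemma integrable_affine (a b : R) (f : R -> R) : a != 0 ->
  mu.-integrable setT (EFin \o f) ->
  mu.-integrable setT (EFin \o (fun x => f (a * x + b))).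
Proof.
move=> a0 /integrableP[mf fi]; apply/integrableP; split.
  apply/measurable_EFinP; apply: (measurableT_comp _ (measurable_affine a b)).
  exact/measurable_EFinP.
have an0 : (0 < `|a|%:E)%E by rewrite lte_fin normr_gt0.
rewrite -(lte_pmul2l _ an0)// /= mulry gtr0_sg ?normr_gt0// mul1e.
rewrite -(ge0_integral_affine b a0 (f := fun x => (`|f x|)%:E))//.
by apply/measurable_EFinP/measurableT_comp => //; exact/measurable_EFinP.
Qed.

Lemma Rintegral_affine (a b : R) (f : R -> R) : a != 0 ->
  mu.-integrable setT (EFin \o f) ->
  \int[mu]_x f x = `|a| * \int[mu]_x f (a * x + b).
Proof.
move=> a0 fi; have fai := integrable_affine b a0 fi.
have mf : measurable_fun setT f by apply/measurable_EFinP; exact: (measurable_int mu fi).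
rewrite -RintegralZl// /Rintegral; congr fine.
transitivity (\int[mu]_x (`|a|%:E * (f (a * x + b)%R)%:E))%E; last exact: eq_integral.
rewrite integralZl//=.
rewrite integralE [X in (_ * X)%E]integralE muleBr//.
- congr (_ - _)%E.
  + rewrite (ge0_integral_affine b a0 (f := (EFin \o f)^\+%E))//.
      by rewrite !funepos.unlock.
    by apply: measurable_funepos; exact/measurable_EFinP.
  + rewrite (ge0_integral_affine b a0 (f := (EFin \o f)^\-%E))//.
      by rewrite !funeneg.unlock.
    by apply: measurable_funeneg; exact/measurable_EFinP.
- exact: integrable_add_def fai.
Qed.

Lemma cintegrable_affine (a b : R) (F : R -> C) : a != 0 ->
  cintegrable mu F -> cintegrable mu (fun x => F (a * x + b)).
Proof.
move=> a0 [F1 F2]; split.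
- exact: (@integrable_affine a b (fun x => RE (F x)) a0 F1).
- exact: (@integrable_affine a b (fun x => IM (F x)) a0 F2).
Qed.

Lemma cintegral_affine (a b : R) (F : R -> C) : a != 0 ->
  cintegrable mu F ->
  cintegral mu setT F = `|a|%:C * cintegral mu setT (fun x => F (a * x + b)).
Proof.
move=> a0 [F1 F2]; rewrite /cintegral.
rewrite (@Rintegral_affine a b (fun x => RE (F x)) a0 F1).
rewrite (@Rintegral_affine a b (fun x => IM (F x)) a0 F2).
by apply/eqP; rewrite eq_complex /= !mul0r subr0 addr0 !eqxx.
Qed.

Lemma continuous_FTC2_is_derive (F f : R -> R) (a b : R) : a < b ->
  (forall x, a <= x <= b -> is_derive x 1 F (f x)) ->
  (forall x, a <= x <= b -> {for x, continuous f}) ->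
  mu.-integrable `[a, b] (EFin \o f) /\ \int[mu]_(x in `[a, b]) f x = F b - F a.
Proof.
move=> ab dF cf.
have cfab : {within `[a, b], continuous f}.
  by apply: continuous_in_subspaceT => x; rewrite inE/= in_itv/= => /cf.
split.
  by apply: continuous_compact_integrable => //; exact: segment_compact.
rewrite /Rintegral (continuous_FTC2 ab cfab (F := F))//.
- have cF x : a <= x <= b -> {for x, continuous F}.
    move=> /dF dFx; apply: differentiable_continuous.
    by apply/derivable1_diffP; case: dFx.
  split.
  + by move=> x; rewrite in_itv/= => /andP[ax xb]; have [] := dF x; rewrite ?(ltW ax) ?(ltW xb).
  + by apply: cvg_at_right_filter; apply: cF; rewrite lexx ltW.
  + by apply: cvg_at_left_filter; apply: cF; rewrite lexx ltW.
- move=> x; rewrite in_itv/= => /andP[ax xb].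
  have dFx : is_derive x 1 F (f x) by apply: dF; rewrite (ltW ax) (ltW xb).
  by rewrite derive1E derive_val.
Qed.

(** This function is the majorant used on vertical lines, and also for the tail of the Gamma
    integrand. *)
Lemma integrable_oneDsqrV : mu.-integrable setT (EFin \o (fun t : R => (1 + t ^+ 2)^-1)).
Proof.
have mf : measurable_fun setT (fun t : R => (1 + t ^+ 2)^-1).
  by apply: continuous_measurable_fun; exact: continuous_oneDsqrV.
have f0 (x : R) : 0 <= (1 + x ^+ 2)^-1 by rewrite invr_ge0 addr_ge0 ?sqr_ge0.
apply/integrableP; split; first exact/measurable_EFinP.
under eq_integral => x _ do rewrite /= ger0_norm//.
rewrite ge0_symfun_integralT//; last 2 first.
- by move=> x; exact: continuous_oneDsqrV.
- by move=> x /=; rewrite sqrrN.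
rewrite (_ : [set x | _] = `[0%R, +oo[%classic); last first.
  by apply/seteqP; split=> x /=; rewrite in_itv/= andbT.
by rewrite integral0y_oneDsqr -EFinM ltry.
Qed.

End LebesgueReal.

(** * The Gamma and Beta functions *)

Section PowerKernel.
Context {R : realType}.
Local Notation C := R[i].
Local Notation mu := (@lebesgue_measure R).

Lemma realC_sub1 (a : R) : a%:C - 1 = (a - 1)%:C :> C.
Proof. by rewrite rmorphB rmorph1. Qed.

Lemma is_derive_cpow (z : C) (t : R) : 0 < t ->
  is_derive t 1 (fun t => RE (cpow t z)) (RE (z * cpow t (z - 1))) /\
  is_derive t 1 (fun t => IM (cpow t z)) (IM (z * cpow t (z - 1))).
Proof.
move=> t0; case: z => a b.
have dln c : is_derive t 1 (fun t => c * ln t) (c / t).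
  have := is_derive1_ln t0 => dl.
  by apply: is_derive_eq; rewrite /GRing.scale/=.
have dE : is_derive t 1 (fun t => expR (a * ln t)) (expR (a * ln t) * (a / t)).
  exact: (@is_derive1_comp _ expR (fun t => a * ln t)).
have dC : is_derive t 1 (fun t => cos (b * ln t)) (- sin (b * ln t) * (b / t)).
  exact: (@is_derive1_comp _ cos (fun t => b * ln t)).
have dS : is_derive t 1 (fun t => sin (b * ln t)) (cos (b * ln t) * (b / t)).
  exact: (@is_derive1_comp _ sin (fun t => b * ln t)).
have Et : expR ((a - 1) * ln t) = expR (a * ln t) / t.
  by rewrite mulrBl mul1r expRD expRN lnK.
split.
- rewrite (_ : (fun _ => _) = (fun t => expR (a * ln t)) * (fun t => cos (b * ln t))).
    apply: is_derive_eq; rewrite /cpow/= /GRing.scale/= oppr0 addr0 Et.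
    by ring.
  by apply/funext => x; rewrite /cpow/= mul0r subr0.
- rewrite (_ : (fun _ => _) = (fun t => expR (a * ln t)) * (fun t => sin (b * ln t))).
    apply: is_derive_eq; rewrite /cpow/= /GRing.scale/= oppr0 addr0 Et.
    by ring.
  by apply/funext => x; rewrite /cpow/= mul0r addr0.
Qed.

Lemma continuous_cpow (z : C) (t : R) : 0 < t ->
  {for t, continuous (fun t => RE (cpow t z))} /\
  {for t, continuous (fun t => IM (cpow t z))}.
Proof.
move=> t0; have [d1 d2] := is_derive_cpow z t0.
by split; apply: differentiable_continuous; apply/derivable1_diffP;
  [case: d1|case: d2].
Qed.

Lemma cintegral_cpow_segment (z : C) (e : R) : 0 < e < 1 ->
  cintegral mu `[e, 1[%classic (fun t : R => z * cpow t (z - 1)) = 1 - cpow e z.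
Proof.
move=> /andP[e0 e1].
have c1 (x : R) : e <= x <= 1 -> {for x, continuous (fun t => RE (z * cpow t (z - 1)))}.
  move=> /andP[ex _]; have [] := continuous_cpow (z - 1) (lt_le_trans e0 ex).
  case: z => a b; set w := (_ - 1) => cR cI.
  rewrite (_ : (fun _ => _) = (fun t => a * RE (cpow t w)) \- (fun t => b * IM (cpow t w))) //.
  by apply: continuousB; apply: continuousM => //; exact: cst_continuous.
have c2 (x : R) : e <= x <= 1 -> {for x, continuous (fun t => IM (z * cpow t (z - 1)))}.
  move=> /andP[ex _]; have [] := continuous_cpow (z - 1) (lt_le_trans e0 ex).
  case: z {c1} => a b; set w := (_ - 1) => cR cI.
  rewrite (_ : (fun _ => _) = (fun t => a * IM (cpow t w)) \+ (fun t => b * RE (cpow t w))) //.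
  by apply: continuousD; apply: continuousM => //; exact: cst_continuous.
have d1 (x : R) : e <= x <= 1 ->
    is_derive x 1 (fun t => RE (cpow t z)) (RE (z * cpow x (z - 1))).
  by move=> /andP[ex _]; have [] := is_derive_cpow z (lt_le_trans e0 ex).
have d2 (x : R) : e <= x <= 1 ->
    is_derive x 1 (fun t => IM (cpow t z)) (IM (z * cpow x (z - 1))).
  by move=> /andP[ex _]; have [] := is_derive_cpow z (lt_le_trans e0 ex).
have [i1 E1] := continuous_FTC2_is_derive e1 d1 c1.
have [i2 E2] := continuous_FTC2_is_derive e1 d2 c2.
have sub : `[e, 1[%classic `<=` `[e, 1]%classic.
  by move=> x /=; rewrite !in_itv/= => /andP[-> /ltW].
rewrite /cintegral Rintegral_itv_bndo_bndc; last first.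
  exact: integrableS i1.
rewrite Rintegral_itv_bndo_bndc; last exact: integrableS i2.
rewrite E1 E2 cpow1.
by apply/eqP; rewrite eq_complex; case: (cpow e z) => ? ? /=; rewrite !eqxx.
Qed.

(** Monotone convergence: away from 0 the fundamental theorem of calculus, with primitive
    [t ^ a / a], bounds the integral by [1 / a]. *)
Lemma integrable_power01 (a : R) : 0 < a ->
  mu.-integrable setT (EFin \o (fun t : R => \1_`]0, 1]%classic t * expR ((a - 1) * ln t))).
Proof.
move=> a0.
have mf : measurable_fun [set: measurableTypeR R] (fun t : R => expR ((a - 1) * ln t)).
  apply: measurableT_comp; first exact: measurable_expR.
  by apply: measurable_funM => //; exact: measurable_ln.
(* Starting at [n + 2] keeps the left endpoint strictly below 1, so that each segment is
   nondegenerate. *)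
pose F (n : nat) : set (measurableTypeR R) := `[n.+2%:R^-1, 1]%classic.
have UF : \bigcup_i F i = `]0, 1]%classic.
  apply/seteqP; split => x /=.
    by move=> [n _]; rewrite /F/= !in_itv/= => /andP[nx ->]; rewrite (lt_le_trans _ nx)//.
  rewrite in_itv/= => /andP[x0 x1]; exists (Num.truncn x^-1) => //.
  rewrite /F/= in_itv/= x1 andbT -[leRHS]invrK lef_pV2 ?posrE ?invr_gt0//.
  rewrite ltW// (lt_trans (truncnS_gt _))// ltr_nat.
  by [].
apply/integrableP; split.
  by apply/measurable_EFinP; apply: measurable_funM => //; exact: measurable_indic.
set I := (X in (X < _)%E).
have {I}-> : I = (\int[mu]_(x in `]0%R, 1%R]) (expR ((a - 1) * ln x))%:E)%E.
  rewrite [RHS]integral_mkcond; apply: eq_integral => x _.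
  rewrite patchE /= indicE; case: ifPn => _.
    by rewrite mul1r ger0_norm ?expR_ge0.
  by rewrite mul0r normr0.
rewrite -UF.
have Fn i : (\int[mu]_(x in F i) (expR ((a - 1) * ln x))%:E <= (a^-1)%:E)%E.
  have i01 : (i.+2%:R^-1 : R) < 1 by rewrite invf_lt1// ltr1n.
  pose G (t : R) := a^-1 * RE (cpow t a%:C).
  have dG (x : R) : i.+2%:R^-1 <= x <= 1 -> is_derive x 1 G (expR ((a - 1) * ln x)).
    move=> /andP[ix _]; have x0 : 0 < x by rewrite (lt_le_trans _ ix).
    have [d1 _] := is_derive_cpow a%:C x0.
    rewrite /G; apply: is_derive_eq.
    rewrite realC_sub1 cpow_real /GRing.scale/= mulr0 subr0.
    by rewrite mulKf ?gt_eqF.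
  have cf (x : R) : i.+2%:R^-1 <= x <= 1 -> {for x, continuous (fun x => expR ((a - 1) * ln x))}.
    move=> /andP[ix _]; have x0 : 0 < x by rewrite (lt_le_trans _ ix).
    have [+ _] := continuous_cpow (a - 1)%:C x0.
    rewrite (_ : (fun t => RE (cpow t _)) = (fun x => expR ((a - 1) * ln x)))//.
    by apply/funext => y; rewrite cpow_real.
  have [fi E] := continuous_FTC2_is_derive i01 dG cf.
  have fn := @integrable_fin_num _ _ _ _ _ _ _ fi.
  rewrite -(fineK (fn _))// lee_fin.
  move: E; rewrite /Rintegral => ->.
  rewrite /G cpow1 cpow_real mulr1 lerBlDr lerDl mulr_ge0 ?invr_ge0 ?ltW//.
  exact: expR_gt0.
have ndF : {homo F : n m / (n <= m)%N >-> (n <= m)%O}.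
  move=> n m nm; apply/subsetPset => x; rewrite /F/= !in_itv/= => /andP[nx ->].
  rewrite andbT (le_trans _ nx)// lef_pV2 ?posrE// ler_nat//.
have := @ge0_nondecreasing_set_cvg_integral _ _ _ F (EFin \o (fun t : R => expR ((a - 1) * ln t))) mu ndF.
move=> /(_ (fun=> measurable_itv _)) /(_ (fun i => measurable_funTS (proj2 (measurable_EFinP _ _) mf))).
move=> /(_ (fun i x _ => expR_ge0 _)) cv.
apply: le_lt_trans (ltry a^-1).
rewrite -(cvg_lim _ cv)//; apply: lime_le; first by apply/cvg_ex; eexists; exact: cv.
by apply: nearW.
Qed.

Definition power01 (z : C) (t : R) : C := (\1_`]0, 1[%classic t)%:C * cpow t (z - 1).

Lemma cmeasurable_power01 (z : C) : cmeasurable (power01 z : measurableTypeR R -> C).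
Proof.
apply: cmeasurableM; first by apply: cmeasurable_real; exact: measurable_indic.
by apply: cmeasurable_cpow => //; exact: cmeasurable_cst.
Qed.

Lemma RE_sub1 (z : C) : RE (z - 1) = RE z - 1. Proof. by case: z. Qed.

Lemma cintegrable_power01 (z : C) : 0 < RE z -> cintegrable mu (power01 z).
Proof.
move=> z0; apply: le_cintegrable (integrable_power01 z0).
  exact: cmeasurable_power01.
move=> x; rewrite /power01 Normc.normcM normc_real normc_cpow !RE_sub1.
rewrite ler_wpM2r ?expR_ge0// ger0_norm// !indicE ler_nat.
have [/[!inE]|//] := boolP (_ \in `]0, 1[%classic).
by rewrite /= in_itv/= => /andP[x0 x1]; rewrite mem_set//= in_itv/= x0 ltW.
Qed.

(* With [I] the integral, scaling gives [e ^ z * I] on [(0, e)] and the fundamental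
   theorem of calculus [(1 - e ^ z) / z] on [[e, 1)]; [e = 1/2] is enough, so no
   limit [e -> 0] is needed. *)
Lemma cintegral_power01 (z : C) : 0 < RE z -> cintegral mu setT (power01 z) = z^-1.
Proof.
move=> z0.
pose e : R := 2^-1.
have e0 : 0 < e by rewrite invr_gt0.
have e1 : e < 1 by rewrite invf_lt1// ltr1n.
have iz := cintegrable_power01 z0.
pose low (t : R) : C := (\1_`]0, e[%classic t)%:C * cpow t (z - 1).
pose high (t : R) : C := (\1_`[e, 1[%classic t)%:C * cpow t (z - 1).
have split01 t : power01 z t = low t + high t.
  rewrite /power01 /low /high -mulrDl -rmorphD/= !indicE; congr (_%:C * _).
  rewrite -natrD; congr (_%:R).
  rewrite !mem_setE !in_itv/=.
  have [te|et] := ltP t e; first by rewrite (lt_trans te e1) /= addn0.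
  by rewrite (lt_le_trans e0 et) andbF.
have mlow : cmeasurable (low : measurableTypeR R -> C).
  apply: cmeasurableM; first by apply: cmeasurable_real; exact: measurable_indic.
  by apply: cmeasurable_cpow => //; exact: cmeasurable_cst.
have mhigh : cmeasurable (high : measurableTypeR R -> C).
  apply: cmeasurableM; first by apply: cmeasurable_real; exact: measurable_indic.
  by apply: cmeasurable_cpow => //; exact: cmeasurable_cst.
have indic_le (A B : set R) t : A `<=` B -> `|\1_A t| <= `|\1_B t| :> R.
  move=> AB; rewrite !ger0_norm// !indicE ler_nat.
  by have [/set_mem/AB ?|//] := boolP (t \in A); rewrite mem_set.
have ilow : cintegrable mu low.
  apply: le_cintegrable (integrable_normc iz) => // t.
  rewrite /low /power01 [leLHS]Normc.normcM [leRHS]Normc.normcM ler_wpM2r ?normc_ge0// !normc_real.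
  apply: (indic_le _ _ t) => x /=; rewrite !in_itv/= => /andP[-> xe]; exact: lt_trans xe e1.
have ihigh : cintegrable mu high.
  apply: le_cintegrable (integrable_normc iz) => // t.
  rewrite /high /power01 [leLHS]Normc.normcM [leRHS]Normc.normcM ler_wpM2r ?normc_ge0// !normc_real.
  by apply: (indic_le _ _ t) => x /=; rewrite !in_itv/= => /andP[ex ->]; rewrite (lt_le_trans e0).
have E : cintegral mu setT (power01 z) = cintegral mu setT low + cintegral mu setT high.
  by rewrite -cintegralD//; apply: eq_cintegral.
have Elow : cintegral mu setT low = cpow e z * cintegral mu setT (power01 z).
  rewrite (@cintegral_affine _ e 0)//; last by rewrite gt_eqF.
  rewrite -!cintegralZ//; last first.
    by apply: cintegrable_affine => //; rewrite gt_eqF.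
  apply: eq_cintegral => t; rewrite /low /power01 addr0.
  have -> : \1_`]0, e[%classic (e * t) = \1_`]0, 1[%classic t :> R.
    rewrite !indicE !mem_setE !in_itv/= pmulr_rgt0//; congr (_ && _)%:R.
    by rewrite -{2}(mulr1 e) ltr_pM2l.
  rewrite indicE; have [/set_mem/=|_] := boolP (t \in _); last by rewrite !mul0r !mulr0.
  rewrite in_itv/= => /andP[t0 t1]; rewrite !mul1r cpowM// mulrA gtr0_norm//.
  rewrite -{1}(cpow_nat1 e0) -cpowD; congr (cpow _ _ * _); ring.
have Ehigh : z * cintegral mu setT high = 1 - cpow e z.
  rewrite -(@cintegral_cpow_segment z e) ?e0// -cintegralZ// [RHS]cintegral_mkcond.
  apply: eq_cintegral => t; rewrite /high; ring.
have ez : cpow e z != 1.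
  apply/eqP => /(congr1 (@Normc.normc R)); rewrite normc_cpow Normc.normc1 => /eqP.
  by rewrite lt_eqF// -[ltRHS]expR0 ltr_expR pmulr_rlt0// ln_lt0// e0.
have zn0 : z != 0 by apply: contraTneq z0 => ->; rewrite ltxx.
have ez' : 1 - cpow e z != 0 by rewrite subr_eq0 eq_sym.
have : z * ((1 - cpow e z) * cintegral mu setT (power01 z)) = 1 - cpow e z.
  by rewrite -[RHS]Ehigh; congr (_ * _); rewrite mulrBl mul1r -Elow E addrAC subrr add0r.
move=> /(congr1 (fun x => x / (1 - cpow e z))); rewrite divff// => H.
apply: (mulfI zn0); rewrite divff// -H.
by field.
Qed.

End PowerKernel.

(** * Euler's integral: convergence, positivity on the real axis, bound by the real part *)

Section GammaFunction.
Context {R : realType}.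
Local Notation C := R[i].
Local Notation mu := (@lebesgue_measure R).

Definition gamma_kernel (z : C) (t : R) : C :=
  (\1_`]0, +oo[%classic t)%:C * (cpow t (z - 1) * (expR (- t))%:C).

Definition rgamma_kernel (a t : R) : R :=
  \1_`]0, +oo[%classic t * (expR ((a - 1) * ln t) * expR (- t)).

Lemma indic_pos (t : R) : \1_`]0, +oo[%classic t = (0 < t)%R%:R :> R.
Proof. by rewrite indicE mem_setE in_itv/= andbT. Qed.

Lemma rgamma_kernel_ge0 a t : 0 <= rgamma_kernel a t.
Proof. by rewrite mulr_ge0// mulr_ge0// expR_ge0. Qed.

Lemma gamma_kernel_real (a t : R) : gamma_kernel a%:C t = (rgamma_kernel a t)%:C.
Proof. by rewrite /gamma_kernel realC_sub1 cpow_real -!rmorphM. Qed.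

Lemma normc_gamma_kernel (z : C) t : cnorm (gamma_kernel z t) = rgamma_kernel (RE z) t.
Proof.
rewrite /gamma_kernel Normc.normcM [X in _ * X]Normc.normcM !normc_real normc_cpow RE_sub1.
by rewrite !ger0_norm ?expR_ge0.
Qed.

Lemma cmeasurable_gamma_kernel (z : C) :
  cmeasurable (gamma_kernel z : measurableTypeR R -> C).
Proof.
apply: cmeasurableM; first by apply: cmeasurable_real; exact: measurable_indic.
apply: cmeasurableM; first by apply: cmeasurable_cpow => //; exact: cmeasurable_cst.
apply: cmeasurable_real; apply: measurableT_comp; first exact: measurable_expR.
exact: (measurable_funN (@measurable_id _ _ setT)).
Qed.

(** The majorant is [t ^ (a - 1)] on []0, 1]] and [K / (1 + t ^ 2)] beyond 1, where [(1 + t ^ 2) t ^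
    (a - 1) <= 2 t ^ (a + 1) <= 2 t ^ (k + 1) <= K e ^ t]. The choice of [k] gives [a < k], and the
    last inequality keeps one term of the exponential series. *)
Lemma integrable_rgamma_kernel (a : R) : 0 < a ->
  mu.-integrable setT (EFin \o rgamma_kernel a).
Proof.
move=> a0.
pose k := (Num.truncn a).+1.
pose K : R := 2 * (k.+1)`!%:R.
have iK := integrableZl measurableT K (@integrable_oneDsqrV R).
have := integrableD measurableT (integrable_power01 a0) iK.
apply: le_integrable => //.
  have [+ _] := cmeasurable_gamma_kernel a%:C.
  by under eq_fun do rewrite gamma_kernel_real; move=> ?; apply/measurable_EFinP.
move=> t _ /=; rewrite lee_fin.
rewrite (ger0_norm (rgamma_kernel_ge0 _ _)).
apply: le_trans (ler_norm _).
have V0 : 0 <= (1 + t ^+ 2)^-1 by rewrite invr_ge0 addr_ge0 ?sqr_ge0.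
have K0 : 0 <= K by rewrite mulr_ge0.
rewrite /rgamma_kernel indic_pos indicE mem_setE in_itv/=.
have [t0|] := ltP 0 t; last by rewrite !mul0r add0r mulr_ge0.
have [t1|t1] := leP t 1.
  rewrite /= !mul1r -[leLHS]addr0 lerD//; last by rewrite mulr_ge0.
  by rewrite -[leRHS]mulr1 ler_wpM2l ?expR_ge0// -expR0 ler_expR oppr_le0 ltW.
rewrite /= mul1r mul0r add0r ler_pdivlMr; last by rewrite ltr_pwDl ?sqr_ge0.
have lnt0 : 0 <= ln t by rewrite ln_ge0// ltW.
have h1 : 1 + t ^+ 2 <= 2 * expR (2 * ln t).
  by rewrite mulr_natl expRM_natl lnK// mulr2n lerD2r expr_ge1// ltW.
have h2 : expR ((a - 1) * ln t) * expR (2 * ln t) <= t ^+ k.+1.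
  rewrite -expRD -mulrDl -{2}(lnK t0) -expRM_natl ler_expR ler_wpM2r//.
  rewrite -natr1 /k; have := truncnS_gt a; lra.
have h3 : t ^+ k.+1 <= (k.+1)`!%:R * expR t.
  have := @expR_ge1Dxn _ t k (ltW t0).
  rewrite -ler_pdivrMl ?ltr0n ?fact_gt0// => h; rewrite mulrC.
  by rewrite (le_trans _ h)// lerDr.
have e0 := expR_gt0 ((a - 1) * ln t).
have en0 := expR_gt0 (- t).
have e3 : expR t * expR (- t) = 1 by rewrite -expRD subrr expR0.
apply: (@le_trans _ _ ((expR ((a - 1) * ln t) * expR (-t)) * (2 * expR (2 * ln t)))).
  by rewrite ler_wpM2l// mulr_ge0// ltW.
rewrite (_ : _ * _ = 2 * (expR ((a - 1) * ln t) * expR (2 * ln t)) * expR (- t)); last by ring.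
apply: (@le_trans _ _ (2 * ((k.+1)`!%:R * expR t) * expR (-t))).
  rewrite ler_wpM2r ?(ltW en0)// ler_wpM2l//.
  exact: le_trans h2 h3.
by rewrite -!mulrA e3 mulr1.
Qed.

Lemma cintegrable_gamma_kernel (z : C) : 0 < RE z ->
  cintegrable mu (gamma_kernel z).
Proof.
move=> z0; apply: le_cintegrable (integrable_rgamma_kernel z0).
  exact: cmeasurable_gamma_kernel.
by move=> t; rewrite normc_gamma_kernel.
Qed.

Lemma GammaE (z : C) : 0 < RE z -> Gamma z = cintegral mu setT (gamma_kernel z).
Proof.
move=> z0; rewrite /Gamma z0 big_ord0 divr1 addr0 /euler_Gamma.
by rewrite cintegral_mkcond.
Qed.

Definition rGamma (a : R) : R := \int[mu]_t rgamma_kernel a t.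

Lemma Gamma_real (a : R) : 0 < a -> Gamma a%:C = (rGamma a)%:C.
Proof.
move=> a0; rewrite GammaE//; under eq_cintegral do rewrite gamma_kernel_real.
exact: cintegral_real.
Qed.

Lemma normc_Gamma_le (z : C) : 0 < RE z -> cnorm (Gamma z) <= rGamma (RE z).
Proof.
move=> z0; rewrite GammaE//.
apply: le_trans (le_normc_cintegral (cintegrable_gamma_kernel z0)) _.
by rewrite /rGamma; under eq_Rintegral do rewrite normc_gamma_kernel.
Qed.

(** On []1, 2[] both [ln t] and [t] lie between 0 and 2, so the integrand is at least the constant
    [c] on an interval of length 1. *)
Lemma rGamma_gt0 (a : R) : 0 < a -> 0 < rGamma a.
Proof.
move=> a0.
pose c := expR (- 2 * `|a - 1| - 2).
have ic : mu.-integrable setT (EFin \o (fun t : R => c * \1_`]1, 2[%classic t)).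
  exact: (integrableZl measurableT c (integrable_indic_itv 1 2 false true)).
apply: (@lt_le_trans _ _ (\int[mu]_t (c * \1_`]1, 2[%classic t))).
  rewrite RintegralZl//; last exact: (integrable_indic_itv 1 2 false true).
  rewrite mulr_gt0 ?expR_gt0// /Rintegral integral_indic// setIT.
  have E : mu `](1 : R), 2[%classic = 1%:E.
    rewrite lebesgue_measure_itv/= lte_fin ltr1n -EFinB; congr EFin.
    by rewrite [X in X - _ = _](natrD _ 1 1) addrK.
  by rewrite [X in fine X]E.
apply: le_Rintegral => //; first exact: integrable_rgamma_kernel.
move=> t _; rewrite indicE mem_setE in_itv/=.
have [/andP[t1 t2]|_] := boolP (1 < t < 2); last by rewrite mulr0 rgamma_kernel_ge0.
have t0 : 0 < t by rewrite (lt_trans _ t1).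
rewrite mulr1 /rgamma_kernel indic_pos t0 mul1r -expRD ler_expR.
have l1 : 0 <= ln t by rewrite ln_ge0// ltW.
have l2 : ln t <= 2 by have := ln_sublinear t0; lra.
apply: lerD; last by rewrite lerN2 ltW.
rewrite mulNr lerNl -mulNr.
apply: (@le_trans _ _ (`|a - 1| * ln t)).
  by rewrite ler_wpM2r// -normrN ler_norm.
by rewrite [leRHS]mulrC ler_wpM2l.
Qed.

Lemma Gamma1 : Gamma (1 : C) = 1.
Proof.
rewrite (Gamma_real ltr01) /rGamma /Rintegral.
rewrite (_ : integral _ _ _ = 1%E)//.
transitivity (\int[mu]_(x in `]0%R, +oo[) (expR (- x))%:E)%E.
  rewrite [RHS]integral_mkcond; apply: eq_integral => t _.
  rewrite patchE /rgamma_kernel subrr mul0r expR0 mul1r indicE.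
  by case: ifPn => _; rewrite ?mul1r ?mul0r.
rewrite integral_itv_obnd_cbnd; last first.
  apply: measurable_funTS; apply/measurable_EFinP.
  by apply: measurableT_comp; [exact: measurable_expR|exact: (measurable_funN (@measurable_id _ _ setT))].
rewrite -(integral_exponential_pdf (ltr01 : 0 < 1 :> R)) integral_mkcond.
apply: eq_integral => t _; rewrite patchE mem_setE in_itv/= andbT.
case: ifPn => t0; last by rewrite lt0_exponential_pdf// ltNge.
by rewrite exponential_pdfE// mul1r mulN1r.
Qed.

End GammaFunction.

(** * The Beta integral, the functional equation of Gamma and its decay on vertical lines *)

Section BetaFunction.
Context {R : realType}.
Local Notation C := R[i].
Local Notation mu := (@lebesgue_measure R).

Lemma RED (z w : C) : RE (z + w) = RE z + RE w.
Proof. by case: z; case: w. Qed.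

Lemma cintegrable_convolution (F G : R -> C) :
  cintegrable mu F -> cintegrable mu G ->
  cintegrable (mu \x mu)%E (fun z => F z.1 * G (z.2 - z.1)).
Proof.
move=> iF iG.
have mF := cintegrable_cmeasurable iF; have mG := cintegrable_cmeasurable iG.
have mFG : cmeasurable (fun z : measurableTypeR R * measurableTypeR R => F z.1 * G (z.2 - z.1)).
  apply: cmeasurableM.
    by apply: cmeasurable_comp mF _; exact: measurable_fst.
  apply: (cmeasurable_comp (h := fun z : measurableTypeR R * measurableTypeR R => (z.2 - z.1 : measurableTypeR R)) mG).
  by apply: measurable_funB; [exact: measurable_snd|exact: measurable_fst].
apply: (le_cintegrable (g := fun z : measurableTypeR R * measurableTypeR R => cnorm (F z.1) * cnorm (G (z.2 - z.1))) mFG).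
  by move=> z; rewrite Normc.normcM.
have mN : measurable_fun setT
    (fun z : measurableTypeR R * measurableTypeR R => cnorm (F z.1) * cnorm (G (z.2 - z.1))).
  by under eq_fun do rewrite -Normc.normcM; exact: measurable_normc.
apply/integrable12ltyP; first exact/measurable_EFinP.
have mNG := measurable_normc mG; have mNF := measurable_normc mF.
have E x : (\int[mu]_y `|(EFin \o (fun z => cnorm (F z.1) * cnorm (G (z.2 - z.1)))%R) (x, y)| =
    (cnorm (F x))%:E * \int[mu]_y (cnorm (G y))%:E)%E.
  rewrite (@ge0_integral_affine R 1 (- x) (fun y => (cnorm (G y))%:E))//.
  - rewrite normr1 mul1e -ge0_integralZl_EFin ?normc_ge0//.
    + apply: eq_integral => y _ /=.
      by rewrite mul1r ger0_norm// mulr_ge0// normc_ge0.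
    + by move=> y _; rewrite lee_fin normc_ge0.
    + apply/measurable_EFinP.
      exact: (measurableT_comp mNG (measurable_affine 1 (- x))).
  - exact/measurable_EFinP.
  - by move=> y; rewrite lee_fin normc_ge0.
under eq_integral do rewrite E.
have iN (H : R -> C) : cintegrable mu H -> (\int[mu]_y (cnorm (H y))%:E)%E \is a fin_num.
  move=> iH; exact: (integrable_fin_num measurableT (integrable_normc iH)).
rewrite -(fineK (iN _ iG)).
under eq_integral do rewrite muleC.
rewrite ge0_integralZl_EFin//.
- by rewrite -(fineK (iN _ iF)) -EFinM ltry.
- by move=> y _; rewrite lee_fin normc_ge0.
- exact/measurable_EFinP.
- by rewrite fine_ge0// integral_ge0// => y _; rewrite lee_fin normc_ge0.
Qed.

Lemma cintegral_convolution (F G : R -> C) :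
  cintegrable mu F -> cintegrable mu G ->
  cintegral mu setT (fun r => cintegral mu setT (fun x => F x * G (r - x))) =
  cintegral mu setT F * cintegral mu setT G.
Proof.
move=> iF iG; have iFG := cintegrable_convolution iF iG.
rewrite (cintegral_fubini2 iFG) -(cintegral_fubini1 iFG) /=.
rewrite mulrC -cintegralZ//; apply: eq_cintegral => x.
rewrite cintegralZ; last first.
  have := cintegrable_affine (- x) (oner_neq0 R) iG.
  by under eq_fun do rewrite mul1r.
rewrite mulrC; congr (_ * _).
rewrite [RHS](cintegral_affine (- x) (oner_neq0 R) iG) normr1 mul1r.
by apply: eq_cintegral => y; rewrite mul1r.
Qed.

(** The endpoint [r] is left free because the integral over [x] is a convolution of two powers at
    [r]. This is the form met both when two Gamma integrands are convolved and in the induction for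
    Dirichlet's formula. *)
Definition beta_kernel (a b : C) (r x : R) : C :=
  (\1_`]0, r[%classic x)%:C * (cpow x (a - 1) * cpow (r - x) (b - 1)).

Lemma cmeasurable_beta_kernel (a b : C) r :
  cmeasurable (beta_kernel a b r : measurableTypeR R -> C).
Proof.
apply: cmeasurableM; first by apply: cmeasurable_real; exact: measurable_indic.
apply: cmeasurableM; apply: cmeasurable_cpow => //; try exact: cmeasurable_cst.
by apply: measurable_funB => //.
Qed.

(** The two singularities are separated at 1/2: on the half away from its own singularity, a factor
    satisfies [t ^ (c - 1) <= 1 / t <= 2]. What remains is an integrable power of [x] or, after
    reflection, of [1 - x]. *)
Lemma cintegrable_beta_kernel1 (a b : C) : 0 < RE a -> 0 < RE b ->
  cintegrable mu (beta_kernel a b 1).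
Proof.
move=> a0 b0.
have ia := integrable_normc (cintegrable_power01 a0).
have ib := integrable_normc (cintegrable_power01 b0).
have N10 : (-1 : R) != 0 by rewrite oppr_eq0 oner_neq0.
have {}ib := integrable_affine 1 N10 ib.
have i2 := integrableD measurableT (integrableZl measurableT 2 ia) (integrableZl measurableT 2 ib).
apply: le_cintegrable i2; first exact: cmeasurable_beta_kernel.
move=> x; rewrite /beta_kernel /power01 [leLHS]Normc.normcM.
rewrite ![cnorm (_%:C * cpow _ _)]Normc.normcM [cnorm (cpow _ _ * _)]Normc.normcM.
rewrite !normc_real !normc_cpow !indicE !mem_setE !in_itv/= !RE_sub1.
have -> : -1 * x + 1 = 1 - x by rewrite mulN1r addrC.
rewrite subr_gt0 gtrDl oppr_lt0 [(x < 1) && _]andbC.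
have [/andP[x0 x1]|_] := boolP (0 < x < 1); last first.
  by rewrite normr0 !mul0r mulr0 addr0.
rewrite normr1 !mul1r.
have half (c t : R) : 0 < c -> 2^-1 <= t -> t < 1 -> expR ((c - 1) * ln t) <= 2.
  move=> c0 t2 t1; have t0 : 0 < t by rewrite (lt_le_trans _ t2)// invr_gt0.
  rewrite mulrBl mul1r expRD expRN lnK// ler_pdivrMr//.
  apply: (@le_trans _ _ 1).
    by rewrite -expR0 ler_expR mulr_ge0_le0 ?ln_le0 ?ltW.
  by rewrite -(@ler_pM2l _ 2^-1) ?invr_gt0// mulKf// mulr1.
have e1 := expR_ge0 ((RE a - 1) * ln x).
have e2 := expR_ge0 ((RE b - 1) * ln (1 - x)).
have [x2|x2] := leP x 2^-1.
  apply: (@le_trans _ _ (expR ((RE a - 1) * ln x) * 2)).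
    rewrite ler_wpM2l// half//; lra.
  by rewrite mulrC lerDl mulr_ge0.
apply: (@le_trans _ _ (2 * expR ((RE b - 1) * ln (1 - x)))).
  by rewrite ler_wpM2r// half// ltW.
by rewrite lerDr mulr_ge0.
Qed.

Definition Beta (a b : C) : C := cintegral mu setT (beta_kernel a b 1).

Lemma beta_kernel_scale (a b : C) (r x : R) : 0 < r ->
  beta_kernel a b r x =
  cpow r (a + b - 2) * beta_kernel a b 1 (r^-1 * x + 0).
Proof.
move=> r0; rewrite /beta_kernel addr0 !indicE !mem_setE !in_itv/=.
rewrite pmulr_rgt0 ?invr_gt0// ltr_pdivrMl// mulr1.
have [/andP[x0 xr]|_] := boolP (0 < x < r); last by rewrite !mul0r mulr0.
rewrite !mul1r.
rewrite {1}(_ : x = r * (r^-1 * x)); last by rewrite mulrA divff ?mul1r// gt_eqF.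
rewrite {1}(_ : r - x = r * (1 - r^-1 * x)); last first.
  by rewrite mulrBr mulr1 mulrA divff ?mul1r// gt_eqF.
rewrite !cpowM ?mulr_gt0 ?invr_gt0// ?subr_gt0 ?ltr_pdivrMl ?mulr1//.
rewrite mulrACA -cpowD; congr (cpow _ _ * _); ring.
Qed.

Lemma cintegrable_beta_kernel (a b : C) (r : R) : 0 < RE a -> 0 < RE b -> 0 < r ->
  cintegrable mu (beta_kernel a b r).
Proof.
move=> a0 b0 r0; rewrite (funext (fun x => beta_kernel_scale a b x r0)).
apply/cintegrableZ/cintegrable_affine; first by rewrite invr_eq0 gt_eqF.
exact: cintegrable_beta_kernel1.
Qed.

Lemma cintegral_beta_kernel (a b : C) (r : R) : 0 < RE a -> 0 < RE b -> 0 < r ->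
  cintegral mu setT (beta_kernel a b r) = cpow r (a + b - 1) * Beta a b.
Proof.
move=> a0 b0 r0; rewrite (funext (fun x => beta_kernel_scale a b x r0)).
have ri0 : r^-1 != 0 by rewrite invr_eq0 gt_eqF.
have ib := cintegrable_beta_kernel1 a0 b0.
rewrite cintegralZ; last exact: cintegrable_affine.
rewrite /Beta (cintegral_affine 0 ri0 ib) mulrA; congr (_ * _).
rewrite gtr0_norm ?invr_gt0// (_ : a + b - 1 = (a + b - 2) + 1); last by ring.
rewrite [cpow r (a + b - 2 + 1)]cpowD cpow_nat1// -mulrA -(rmorphM (real_complex R)) divff ?gt_eqF//.
by rewrite mulr1.
Qed.

(** The left side is the integral of the convolution of the two Gamma integrands. At [r] the
    exponentials combine to [e ^ (- r)], and scaling evaluates the rest as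
    [r ^ (a + b - 1) Beta a b]. *)
Lemma Gamma_Beta (a b : C) : 0 < RE a -> 0 < RE b ->
  Gamma a * Gamma b = Beta a b * Gamma (a + b).
Proof.
move=> a0 b0; have ab0 : 0 < RE (a + b) by rewrite RED addr_gt0.
rewrite !GammaE// -cintegral_convolution; try exact: cintegrable_gamma_kernel.
rewrite -cintegralZ; last exact: cintegrable_gamma_kernel.
apply: eq_cintegral => r.
have E x : gamma_kernel a x * gamma_kernel b (r - x) =
    (expR (- r))%:C * beta_kernel a b r x.
  rewrite /gamma_kernel /beta_kernel !indic_pos subr_gt0 indicE mem_setE in_itv/=.
  have [x0|_] := ltP 0 x; last by rewrite !mul0r mulr0.
  have [xr|_] := ltP x r; last by rewrite !mul0r !mulr0.
  rewrite !mul1r.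
  have -> : expR (- r) = expR (- x) * expR (- (r - x)) by rewrite -expRD; congr expR; ring.
  by rewrite rmorphM/=; ring.
under eq_cintegral do rewrite E.
rewrite /gamma_kernel indic_pos; have [r0|r0] := ltP 0 r; last first.
  rewrite mul0r mulr0.
  have E0 x : (expR (- r))%:C * beta_kernel a b r x = (0 : R)%:C.
    rewrite /beta_kernel indicE mem_setE in_itv/=.
    have [x0|_] := ltP 0 x; last by rewrite mul0r mulr0.
    by rewrite ltNge (le_trans r0 (ltW x0)) mul0r mulr0.
  under eq_cintegral do rewrite E0.
  by rewrite cintegral_real /Rintegral integral0.
rewrite mul1r cintegralZ; last exact: cintegrable_beta_kernel.
by rewrite cintegral_beta_kernel//; ring.
Qed.

(** The case [b = 1] of the Beta relation, since [Gamma 1 = 1] and [Beta z 1] is the integral of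
    [x ^ (z - 1)] over []0, 1[], that is [1 / z]; no integration by parts is involved. *)
Lemma Gamma_succ (z : C) : 0 < RE z -> Gamma (z + 1) = z * Gamma z.
Proof.
move=> z0; have := Gamma_Beta z0 (ltr01 : 0 < RE (1 : C)).
rewrite Gamma1 mulr1 => ->.
have -> : Beta z 1 = z^-1.
  rewrite -cintegral_power01//; apply: eq_cintegral => x.
  by rewrite /beta_kernel /power01 subrr cpow0 mulr1.
rewrite mulrA divff ?mul1r//.
by apply: contraTneq z0 => ->; rewrite ltxx.
Qed.

Lemma rGamma_succ (a : R) : 0 < a -> rGamma (a + 1) = a * rGamma a.
Proof.
move=> a0; apply: complexI; rewrite rmorphM/= -!Gamma_real ?addr_gt0//.
by rewrite -Gamma_succ// rmorphD.
Qed.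

Lemma normc_Gamma_decay (a t : R) : 0 < a ->
  cnorm (Gamma (a +i* t)) <= rGamma (a + 2) * (Num.max 1 (a ^+ 2)^-1) * (1 + t ^+ 2)^-1.
Proof.
move=> a0; have z0 : 0 < RE (a +i* t) by [].
have z1 : 0 < RE (a +i* t + 1) by rewrite RED addr_gt0.
have z2 : 0 < RE (a +i* t + 1 + 1) by rewrite RED addr_gt0.
have E : Gamma (a +i* t + 1 + 1) = (a +i* t + 1) * ((a +i* t) * Gamma (a +i* t)).
  by rewrite -!Gamma_succ.
have := normc_Gamma_le z2.
have -> : RE (a +i* t + 1 + 1) = a + 2 by rewrite /= -addrA.
rewrite E; move: (Gamma (a +i* t)) => g; rewrite !Normc.normcM mulrA => H.
have n2 : a ^+ 2 + t ^+ 2 <= cnorm (a +i* t + 1) * cnorm (a +i* t).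
  have -> : a ^+ 2 + t ^+ 2 = cnorm (a +i* t) * cnorm (a +i* t).
    by rewrite /= -expr2 sqr_sqrtr// addr_ge0 ?sqr_ge0.
  rewrite ler_wpM2r ?normc_ge0//= addr0; apply: ler_wsqrtr.
  by rewrite lerD2r; nra.
(* The functional equation yields the factor [a ^ 2 + t ^ 2]; [M] is what it takes to compare it
   with [1 + t ^ 2], the constant term needing [1 / a ^ 2] and the quadratic term 1. *)
set M := Num.max _ _.
have M1 : 1 <= M by rewrite le_max lexx.
have Ma : (a ^+ 2)^-1 <= M by rewrite le_max lexx orbT.
have a2 : 0 < a ^+ 2 by rewrite exprn_gt0.
have n3 : 1 + t ^+ 2 <= M * (a ^+ 2 + t ^+ 2).
  rewrite mulrDr lerD//; last by rewrite ler_peMl ?sqr_ge0.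
  by rewrite -ler_pdivrMr// mul1r.
have pos : 0 < 1 + t ^+ 2 by rewrite ltr_pwDl ?sqr_ge0.
rewrite ler_pdivlMr//.
apply: (@le_trans _ _ (cnorm g * (M * (a ^+ 2 + t ^+ 2)))).
  by rewrite ler_wpM2l ?normc_ge0.
rewrite mulrCA mulrC ler_wpM2r ?(le_trans ler01)//.
apply: le_trans H; rewrite mulrC; apply: ler_wpM2r n2; exact: normc_ge0.
Qed.

End BetaFunction.

(** * Gamma has no zero in the right half-plane *)

Section Nonvanishing.
Context {R : realType}.
Local Notation C := R[i].
Local Notation mu := (@lebesgue_measure R).

Lemma normr_sin_le (u : R) : `|sin u| <= `|u|.
Proof.
have pos (x : R) : 0 < x -> `|sin x| <= x.
  move=> x0.
  have cs : {within `[0, x], continuous (@sin R)}.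
    by apply: continuous_subspaceT => y; exact: continuous_sin.
  have [c _] := @MVT R sin cos 0 x x0 (fun y _ => is_derive_sin y) cs.
  rewrite sin0 !subr0 => ->.
  by rewrite normrM (gtr0_norm x0) -[leRHS]mul1r ler_wpM2r ?cos_max// ltW.
have [u0|u0|->] := ltgtP u 0; last by rewrite sin0.
  by have := pos (- u); rewrite oppr_gt0 sinN normrN (ltr0_norm u0); exact.
by rewrite (gtr0_norm u0) pos.
Qed.

(** Halving the angle, [1 - cos (2 v) = 2 sin v ^ 2 <= 2 v ^ 2]. *)
Lemma cos_ge1B_sqr (u : R) : 1 - cos u <= u ^+ 2 / 2.
Proof.
have -> : u = u / 2 + u / 2 by rewrite -splitr.
move: (u / 2) => v; rewrite cosD.
have := cos2Dsin2 v; have : sin v ^+ 2 <= v ^+ 2.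
  rewrite -[leRHS]real_normK ?num_real// -[leLHS]real_normK ?num_real//.
  by rewrite lerXn2r ?nnegrE// normr_sin_le.
by lra.
Qed.

(** The quadratic bound settles [|u| <= 2], the trivial bound [1 - cos u <= 2] the rest. *)
Lemma cos_ge1B_norm (u : R) : 1 - cos u <= `|u|.
Proof.
have h1 := cos_ge1B_sqr u; have h2 := cos_le1 u; have h3 := cos_geN1 u.
have h4 : u ^+ 2 = `|u| ^+ 2 by rewrite real_normK ?num_real.
rewrite leNgt; apply/negP => h5; have := normr_ge0 u.
by nra.
Qed.

(** For [r = e ^ (2 v)] the bracket is [(e ^ v - e ^ (- v)) ^ 2], which is at least [v ^ 2]. A bound
    in [r] and [1 / r] is wanted because multiplying the Gamma integrand by [t] or [1 / t] only
    shifts its parameter by one. *)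
Lemma sqr_ln_le (r : R) : 0 < r -> ln r ^+ 2 <= 4 * (r - 2 + r^-1).
Proof.
move=> r0.
have -> : r^-1 = expR (- ln r) by rewrite expRN lnK.
rewrite -{2}(lnK r0); move: (ln r) => w.
have -> : w = w / 2 + w / 2 by rewrite -splitr.
move: (w / 2) => v; rewrite (opprD v v) !expRD.
have e : expR v * expR (- v) = 1 by rewrite -expRD subrr expR0.
have h1 := expR_ge1Dx v; have h2 := expR_ge1Dx (- v).
have p1 := expR_gt0 v; have p2 := expR_gt0 (- v).
have -> : 4 * (expR v * expR v - 2 + expR (- v) * expR (- v)) = 4 * (expR v - expR (- v)) ^+ 2.
  rewrite (_ : (expR v - expR (- v)) ^+ 2 =
    expR v * expR v - 2 * (expR v * expR (- v)) + expR (- v) * expR (- v)); last by ring.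
  by rewrite e mulr1.
have [v0|v0] := leP 0 v.
  have : expR (- v) <= 1 by rewrite -expR0 ler_expR oppr_le0.
  by nra.
have : expR v <= 1 by rewrite -expR0 ler_expR ltW.
by nra.
Qed.

(* The Gamma law of parameter [x] concentrates around its mean [x], hence
   [Re (x ^ (- i y) Gamma (x + i y))] is close to [Gamma x] for large [x]. *)
Lemma Gamma_neq0_large (x y : R) : 1 + 2 * y ^+ 2 < x -> Gamma (x +i* y) != 0.
Proof.
move=> xy; apply/eqP => G0.
have x1 : 1 < x by rewrite (le_lt_trans _ xy)// lerDl mulr_ge0// sqr_ge0.
have x0 : 0 < x by rewrite (lt_trans _ x1).
have xm1 : 0 < x - 1 by rewrite subr_gt0.
have xp1 : 0 < x + 1 by rewrite addr_gt0.
have iz := cintegrable_gamma_kernel (x0 : 0 < RE (x +i* y)).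
pose K t : C := cpow x (0 -i* y) * gamma_kernel (x +i* y) t.
have iK : cintegrable mu K by exact: cintegrableZ.
have K0 : cintegral mu setT K = 0 by rewrite cintegralZ// -GammaE// G0 mulr0.
have REK t : RE (K t) = rgamma_kernel x t * cos (y * (ln t - ln x)).
  rewrite /K /gamma_kernel /rgamma_kernel /cpow /= (mulrBr y (ln t)) cosB.
  rewrite mul0r expR0 subr0 mulNr cosN sinN.
  by ring.
have i0 := integrable_rgamma_kernel x0.
have i1 := integrable_rgamma_kernel xm1.
have i2 := integrable_rgamma_kernel xp1.
(* With [w = ln t - ln x], [cos (y w) >= 1 - y ^ 2 w ^ 2 / 2 >= 1 - 2 y ^ 2 (t / x - 2 + x / t)];
   [h] is the Gamma integrand times this lower bound, with the factors [t] and [1 / t] absorbed into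
   the parameters [x + 1] and [x - 1]. *)
pose h t := (1 + 4 * y ^+ 2) * rgamma_kernel x t
  + ((- 2 * y ^+ 2 / x) * rgamma_kernel (x + 1) t
     + (- 2 * y ^+ 2 * x) * rgamma_kernel (x - 1) t).
have j0 := integrableZl measurableT (1 + 4 * y ^+ 2) i0.
have j1 := integrableZl measurableT (- 2 * y ^+ 2 / x) i2.
have j2 := integrableZl measurableT (- 2 * y ^+ 2 * x) i1.
have j12 := integrableD measurableT j1 j2.
have ih : mu.-integrable setT (EFin \o h) := integrableD measurableT j0 j12.
have hK t : h t <= RE (K t).
  rewrite REK /h.
  have [t0|t0] := ltP 0 t; last first.
    by rewrite /rgamma_kernel indic_pos ltNge t0 !mul0r !mulr0 !addr0.
  have -> : rgamma_kernel (x + 1) t = rgamma_kernel x t * t.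
    rewrite /rgamma_kernel (_ : (x + 1 - 1) * ln t = (x - 1) * ln t + ln t); last by ring.
    by rewrite expRD lnK//; ring.
  have -> : rgamma_kernel (x - 1) t = rgamma_kernel x t / t.
    rewrite /rgamma_kernel (_ : (x - 1 - 1) * ln t = (x - 1) * ln t - ln t); last by ring.
    by rewrite [expR (_ - ln t)]expRD expRN lnK//; ring.
  have g0 := rgamma_kernel_ge0 x t.
  have tx0 : 0 < t / x by rewrite divr_gt0.
  have := sqr_ln_le tx0; rewrite ln_div ?posrE// invf_div.
  have := cos_ge1B_sqr (y * (ln t - ln x)).
  rewrite exprMn; move: (cos _) => c; move: (ln t - ln x) => w hc hw.
  rewrite -subr_ge0.
  have -> : rgamma_kernel x t * c -
     ((1 + 4 * y ^+ 2) * rgamma_kernel x t +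
      (-2 * y ^+ 2 / x * (rgamma_kernel x t * t) +
       -2 * y ^+ 2 * x * (rgamma_kernel x t / t)))
    = rgamma_kernel x t * (c - 1 + 2 * y ^+ 2 * (t / x - 2 + x / t)).
    by field; rewrite !gt_eqF.
  apply: mulr_ge0 => //.
  have : y ^+ 2 * w ^+ 2 <= y ^+ 2 * (4 * (t / x - 2 + x / t)).
    by rewrite ler_wpM2l ?sqr_ge0.
  by move: (t / x) (x / t) (y ^+ 2) (w ^+ 2) hc => p q r s; lra.
have [iRK _] := iK.
have := le_Rintegral measurableT ih iRK (fun t _ => hK t).
have -> : \int[mu]_t RE (K t) = 0 by have := congr1 (@complex.Re R) K0.
rewrite RintegralD// RintegralD// !RintegralZl//.
rewrite -!/(rGamma _) rGamma_succ// -[x in rGamma x](subrK 1) rGamma_succ//.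
rewrite leNgt => /negP; apply.
have g0 := rGamma_gt0 xm1.
(* The terms of order [x y ^ 2] cancel, since [t] has mean [x] under the Gamma law; the sign left to
   decide is that of [x - 1 - 2 y ^ 2], which explains the hypothesis on [x]. *)
have -> : (1 + 4 * y ^+ 2) * ((x - 1) * rGamma (x - 1)) +
  (-2 * y ^+ 2 / x * (x * ((x - 1) * rGamma (x - 1))) +
   -2 * y ^+ 2 * x * rGamma (x - 1)) =
  rGamma (x - 1) * (x - 1 - 2 * y ^+ 2) by field; rewrite gt_eqF.
by apply: mulr_gt0 => //; rewrite -opprB oppr_gt0; move: xy; lra.
Qed.

(** By the functional equation a zero at [z] would be a zero at every [z + n]. The imaginary part
    stays fixed, so for large [n] this contradicts the previous lemma. *)
Lemma Gamma_neq0 (z : C) : 0 < RE z -> Gamma z != 0.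
Proof.
move=> z0; apply/eqP => G0.
have H n : 0 < RE (z + n%:R) /\ Gamma (z + n%:R) = 0.
  elim: n => [|n [p IH]]; first by rewrite addr0.
  rewrite -natr1 addrA Gamma_succ// IH mulr0 RED addr_gt0//.
have [_ /eqP] := H (Num.truncn (1 + 2 * IM z ^+ 2)).+1; apply/negP.
set n := _.+1.
have -> m : z + m%:R = (RE z + m%:R) +i* IM z.
  elim: m => [|m IH]; first by case: (z) => a b; rewrite !addr0.
  by rewrite -natr1 addrA IH -natr1 addrA; apply/eqP; rewrite eq_complex/= addr0 !eqxx.
apply: Gamma_neq0_large; apply: (lt_le_trans (truncnS_gt _)).
by rewrite lerDr ltW.
Qed.

End Nonvanishing.

(** * Independence of the contour *)

Section Fejer.
Context {R : realType}.
Local Notation C := R[i].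
Local Notation mu := (@lebesgue_measure R).

(** The Cesaro weights. A sharp cutoff at [N] would give the kernel [2 sin (N u) / u], which need
    not tend to 0 at a fixed [u]; averaging the cutoffs yields a kernel that does. *)
Definition triangle (N t : R) : R := \1_`[- N, N]%classic t * (1 - `|t| / N).

Lemma triangle_ge0_le1 N t : 0 < N -> 0 <= triangle N t <= 1.
Proof.
move=> N0; rewrite /triangle indicE mem_setE in_itv/= -ler_norml.
have [tN|_] := boolP (`|t| <= N); last by rewrite mul0r lexx ler01.
rewrite mul1r subr_ge0 ler_pdivrMr// mul1r tN/= gerBl.
by rewrite divr_ge0// ltW.
Qed.

Lemma measurable_triangle N :
  measurable_fun [set: measurableTypeR R] (triangle N : measurableTypeR R -> R).
Proof.
apply: measurable_funM; first exact: measurable_indic.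
by apply: measurable_funB => //; exact: measurable_funM.
Qed.

Lemma integrable_triangle N : 0 < N -> mu.-integrable setT (EFin \o triangle N).
Proof.
move=> N0; apply: le_integrable (integrable_indic_itv (- N) N true false) => //.
  by apply/measurable_EFinP; exact: measurable_triangle.
move=> t _ /=; rewrite lee_fin; have /andP[k0 k1] := triangle_ge0_le1 t N0.
rewrite ger0_norm// ger0_norm//; move: k1.
by rewrite /triangle indicE; case: (_ \in _); rewrite ?mul1r ?mul0r.
Qed.

Lemma cvg_triangle (t : R) : triangle n.+1%:R t @[n --> \oo] --> (1 : R).
Proof.
rewrite [X in _ --> X](_ : _ = 1 - `|t| * 0); last by rewrite mulr0 subr0.
apply: (@cvg_trans _ ((fun n : nat => 1 - `|t| * n.+1%:R^-1) @ \oo)).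
  apply: near_eq_cvg; near=> n.
  have tn : `|t| <= n.+1%:R.
    by rewrite (le_trans _ (_ : n%:R <= _)) ?ler_nat//; near: n; exact: nbhs_infty_ger.
  by rewrite /triangle indicE mem_setE in_itv/= -ler_norml tn mul1r.
apply: cvgB; first exact: cvg_cst.
apply: cvgM; first exact: cvg_cst.
exact: cvg_harmonic.
Unshelve. all: by end_near. Qed.

(** The Fourier transform of [triangle N], in which only the cosine survives because the weight is
    even. *)
Definition fejer (N u : R) : R := \int[mu]_t (triangle N t * cos (t * u)).

Lemma integrable_triangleM N (f : R -> R) : 0 < N ->
  measurable_fun [set: measurableTypeR R] f -> (forall t, `|f t| <= 1) ->
  mu.-integrable setT (EFin \o (fun t => triangle N t * f t)).
Proof.
move=> N0 mf f1; apply: le_integrable (integrable_triangle N0) => //.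
  by apply/measurable_EFinP; apply: measurable_funM => //; exact: measurable_triangle.
by move=> t _ /=; rewrite lee_fin normrM ler_piMr.
Qed.

Lemma integral_triangle_sin N u : 0 < N ->
  \int[mu]_t (triangle N t * sin (t * u)) = 0.
Proof.
move=> N0.
have ms : measurable_fun [set: measurableTypeR R] (fun t : R => sin (t * u)).
  apply: measurableT_comp; last exact: measurable_funM.
  by apply: continuous_measurable_fun; exact: continuous_sin.
have is_ := integrable_triangleM N0 ms (fun t => sin_max _).
have N10 : (-1 : R) != 0 by rewrite oppr_eq0 oner_neq0.
have E t : triangle N (-1 * t + 0) * sin ((-1 * t + 0) * u) = -1 * (triangle N t * sin (t * u)).
  rewrite mulN1r addr0 mulNr sinN mulrN mulN1r; congr (- (_ * _)).
  by rewrite /triangle normrN !indicE !mem_setE !in_itv/= lerN2 lerNl andbC.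
have := Rintegral_affine 0 N10 is_.
rewrite normrN1 mul1r /=; under [X in _ = X]eq_Rintegral do rewrite E.
rewrite RintegralZl// mulN1r => /eqP.
by rewrite -subr_eq0 opprK -mulr2n mulrn_eq0/= => /eqP.
Qed.

Lemma fejerE (N u : R) : 0 < N -> u != 0 ->
  fejer N u = 2 * (1 - cos (N * u)) / (N * u ^+ 2).
Proof.
move=> N0 u0.
(* The parameter [e] is the sign of [t]: with [|t| = e t] a single primitive [G e], found by
   integration by parts, serves both halves of the interval. *)
pose g (e t : R) := (1 - e * t / N) * cos (t * u).
pose G (e t : R) := (1 - e * t / N) / u * sin (t * u) - e / (N * u ^+ 2) * cos (t * u).
have dG (e t : R) : is_derive t 1 (G e) (g e t).
  have dl : is_derive t 1 (fun t => t * u) u.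
    by apply: is_derive_eq; rewrite /GRing.scale/= mulr0 add0r mulr1.
  have ds : is_derive t 1 (fun t => sin (t * u)) (cos (t * u) * u).
    exact: (@is_derive1_comp _ sin (fun t => t * u)).
  have dc : is_derive t 1 (fun t => cos (t * u)) (- sin (t * u) * u).
    exact: (@is_derive1_comp _ cos (fun t => t * u)).
  have da : is_derive t 1 (fun t => (1 - e * t / N) / u) (- e / N / u).
    by apply: is_derive_eq; rewrite /GRing.scale/= ?mulr0 ?add0r ?mulr1; field; rewrite u0 gt_eqF.
  rewrite (_ : G e = (fun t => (1 - e * t / N) / u) * (fun t => sin (t * u)) -
     (e / (N * u ^+ 2)) *: (fun t => cos (t * u)))//.
  apply: is_derive_eq; rewrite /g /GRing.scale/=; field.
  by rewrite u0 gt_eqF.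
have cg (e t : R) : {for t, continuous (g e)}.
  apply: continuousM.
    apply: continuousB; first exact: cst_continuous.
    by apply: continuousM; [apply: mulrl_continuous|exact: cst_continuous].
  apply: continuous_comp; last exact: continuous_cos.
  exact: mulrr_continuous.
pose h (t : R) := (1 - `|t| / N) * cos (t * u).
have ch (t : R) : {for t, continuous h}.
  apply: continuousM.
    apply: continuousB; first exact: cst_continuous.
    by apply: continuousM; [exact: norm_continuous|exact: cst_continuous].
  apply: continuous_comp; last exact: continuous_cos.
  exact: mulrr_continuous.
have ih : mu.-integrable `[- N, N] (EFin \o h).
  apply: continuous_compact_integrable; first exact: segment_compact.
  by apply: continuous_subspaceT => t; exact: ch.
have NN0 : - N < 0 by rewrite oppr_lt0.
have -> : fejer N u = \int[mu]_(t in `[- N, N]) h t.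
  rewrite /fejer [RHS]Rintegral_mkcond; apply: eq_Rintegral => t _.
  rewrite patchE /triangle /h indicE; case: ifPn => _; rewrite ?mul1r//.
  by rewrite !mul0r.
have [_ E1] := continuous_FTC2_is_derive NN0 (fun t _ => dG (-1) t) (fun t _ => cg (-1) t).
have [_ E2] := continuous_FTC2_is_derive N0 (fun t _ => dG 1 t) (fun t _ => cg 1 t).
have -> : \int[mu]_(t in `[- N, N]) h t =
    \int[mu]_(t in `[- N, 0]) h t + \int[mu]_(t in `[0, N]) h t.
  rewrite -[X in _ + X]Rintegral_itv_obnd_cbnd; last first.
    apply: integrableS ih => // t /=; rewrite !in_itv/= => /andP[t0 ->].
    by rewrite (le_trans (ltW NN0) (ltW t0)).
  rewrite -(@Rintegral_itvB _ h _ _ 0 ih).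
  - by rewrite addrC subrK.
  - by rewrite bnd_simp ltW.
  - by rewrite bnd_simp ltW.
have -> : \int[mu]_(t in `[- N, 0]) h t = \int[mu]_(t in `[- N, 0]) g (-1) t.
  apply: eq_Rintegral => t; rewrite inE/= in_itv/= => /andP[_ t0].
  by rewrite /h /g mulN1r ler0_norm.
have -> : \int[mu]_(t in `[0, N]) h t = \int[mu]_(t in `[0, N]) g 1 t.
  apply: eq_Rintegral => t; rewrite inE/= in_itv/= => /andP[t0 _].
  by rewrite /h /g mul1r ger0_norm.
rewrite E1 E2 /G !mul0r sin0 cos0 !mulNr cosN sinN.
by field; rewrite u0 gt_eqF.
Qed.

(** From [1 - cos (N u) <= N |u|] the factor [N] cancels. Uniformity in [N] is what permits
    dominated convergence later on. *)
Lemma normr_fejer_le (N u : R) : 0 < N -> u != 0 -> `|fejer N u| <= 2 / `|u|.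
Proof.
move=> N0 u0; rewrite fejerE//.
have c0 : 0 <= 1 - cos (N * u) by rewrite subr_ge0 cos_le1.
have nu0 : 0 < `|u| by rewrite normr_gt0.
have Nu0 : 0 < N * u ^+ 2 by rewrite mulr_gt0// exprn_even_gt0 //=.
rewrite ger0_norm; last by rewrite divr_ge0 ?(ltW Nu0)// mulr_ge0.
rewrite ler_pdivrMr// (_ : 2 / `|u| * _ = 2 * (N * `|u|)).
  rewrite ler_wpM2l//; apply: (le_trans (cos_ge1B_norm _)).
  by rewrite normrM (gtr0_norm N0).
by rewrite -[u ^+ 2]real_normK ?num_real//; field; rewrite gt_eqF.
Qed.

Lemma cvg_fejer (u : R) : u != 0 -> fejer n.+1%:R u @[n --> \oo] --> (0 : R).
Proof.
move=> u0; have u2 : 0 < u ^+ 2 by rewrite exprn_even_gt0 //=.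
rewrite [X in _ --> X](_ : _ = 4 / u ^+ 2 * 0); last by rewrite mulr0.
have h : (4 / u ^+ 2 * n.+1%:R^-1) @[n --> \oo] --> 4 / u ^+ 2 * (0 : R).
  by apply: cvgM; [exact: cvg_cst|exact: cvg_harmonic].
rewrite mulr0 in h *.
apply: (@squeeze_cvgr _ _ _ _ (cst 0) _ _ _ _ _ h); last exact: cvg_cst.
apply: nearW => n; rewrite fejerE//.
have c0 : 0 <= 1 - cos (n.+1%:R * u) by rewrite subr_ge0 cos_le1.
apply/andP; split.
  by apply: divr_ge0; apply: mulr_ge0 => //; exact: ltW.
rewrite invfM mulrCA [leRHS]mulrC ler_wpM2l ?invr_ge0//.
rewrite ler_wpM2r ?invr_ge0 ?(ltW u2)//.
by have := cos_geN1 (n.+1%:R * u); lra.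
Qed.

End Fejer.

Section ParametricIntegral.
Context {R : realType} d (T : measurableType d).
Variable m : {sigma_finite_measure set T -> \bar R}.
Local Notation C := R[i].
Local Notation mu := (@lebesgue_measure R).

(* Dividing by [1 + t^2] makes [F] jointly integrable, so Fubini gives measurability in [t]. *)
Lemma cmeasurable_cintegral (F : measurableTypeR R * T -> C) (g : T -> R) :
  cmeasurable F -> (forall t w, cnorm (F (t, w)) <= g w) ->
  m.-integrable setT (EFin \o g) ->
  cmeasurable (fun t : measurableTypeR R => cintegral m setT (fun w => F (t, w))).
Proof.
move=> mF Fg ig.
have mq : measurable_fun [set: measurableTypeR R] (fun t : R => 1 + t ^+ 2).
  by apply: measurable_funD => //; exact: measurable_funX.
have q0 (t : R) : 0 < 1 + t ^+ 2 by rewrite ltr_pwDl ?sqr_ge0.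
have mqV : measurable_fun [set: measurableTypeR R] (fun t : R => (1 + t ^+ 2)^-1).
  by apply: continuous_measurable_fun; exact: continuous_oneDsqrV.
pose F' (z : measurableTypeR R * T) : C := ((1 + z.1 ^+ 2)^-1)%:C * F z.
have mF' : cmeasurable F'.
  apply: cmeasurableM => //; apply: cmeasurable_real.
  by apply: (measurableT_comp mqV); exact: measurable_fst.
have iF' : cintegrable (mu \x m)%E F'.
  apply: le_cintegrable (integrable_prod_fun (@integrable_oneDsqrV R) ig) => //.
  move=> [t w]; rewrite Normc.normcM normc_real ger0_norm ?invr_ge0 ?(ltW (q0 _))//.
  by rewrite ler_wpM2l ?invr_ge0 ?(ltW (q0 _)).
have mI : cmeasurable (fun t : measurableTypeR R => cintegral m setT (fun w => F' (t, w))).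
  have [i1 i2] := iF'; split => /=.
  - by apply: measurableT_comp => //; exact: measurable_fubini_F i1.
  - by apply: measurableT_comp => //; exact: measurable_fubini_F i2.
have := cmeasurableM (cmeasurable_real mq) mI; congr cmeasurable.
apply/funext => t.
have iFt : cintegrable m (fun w => F (t, w)).
  by apply: le_cintegrable ig => //; apply: cmeasurable_comp mF _; exact: measurable_pair1.
rewrite /F' /= cintegralZ// mulrA -rmorphM/= divff ?mul1r//.
by rewrite gt_eqF.
Qed.

End ParametricIntegral.

Section FejerBound.
Context {R : realType}.
Local Notation mu := (@lebesgue_measure R).

Lemma measurable_fejer (N : R) : 0 < N ->
  measurable_fun [set: measurableTypeR R] (fejer N : measurableTypeR R -> R).
Proof.
move=> N0.
have mF : measurable_fun setT (fun z : measurableTypeR R * measurableTypeR R =>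
    triangle N z.2 * cos (z.2 * z.1)).
  apply: measurable_funM.
    by apply: (measurableT_comp (measurable_triangle N)); exact: measurable_snd.
  apply: measurableT_comp.
    by apply: continuous_measurable_fun; exact: continuous_cos.
  by apply: measurable_funM; [exact: measurable_snd|exact: measurable_fst].
have bF (t w : measurableTypeR R) : cnorm (triangle N (t, w).2 * cos ((t, w).2 * (t, w).1))%:C <= triangle N w.
  have /andP[k0 _] := triangle_ge0_le1 w N0.
  by rewrite normc_real normrM ger0_norm// ler_piMr// cos_max.
by have [] := cmeasurable_cintegral (cmeasurable_real mF) bF (integrable_triangle N0).
Qed.

(** Complementary to the bound by [2 / |u|]: this one grows with [N] but holds at [u = 0] too, and
    gives integrability for each fixed [N]. *)
Lemma normr_fejer_bound (N u : R) : 0 < N -> `|fejer N u| <= \int[mu]_t triangle N t.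
Proof.
move=> N0.
have mc : measurable_fun [set: measurableTypeR R] (fun t : R => cos (t * u)).
  apply: measurableT_comp; last exact: measurable_funM.
  by apply: continuous_measurable_fun; exact: continuous_cos.
have ic := integrable_triangleM N0 mc (fun t => cos_max _).
apply: le_trans (le_normr_Rintegral measurableT ic) _.
apply: le_Rintegral => //; [exact: integrable_norm ic|exact: integrable_triangle|].
move=> t _; have /andP[k0 _] := triangle_ge0_le1 t N0.
by rewrite normrM ger0_norm// ler_piMr// cos_max.
Qed.

End FejerBound.

(** * Inversion of Laplace transforms of positive weights *)

Section Laplace.
Context {R : realType} d (T : measurableType d).
Variables (m : {sigma_finite_measure set T -> \bar R}) (rho L : T -> R).
Hypotheses (mrho : measurable_fun setT rho) (mL : measurable_fun setT L).
Hypothesis rho_ge0 : forall w, 0 <= rho w.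
Local Notation C := R[i].
Local Notation mu := (@lebesgue_measure R).

(** The exponent [L] is a function on an abstract space rather than a real coordinate, so that a
    product of transforms is again a transform, with the sum of the exponents on the product
    space. *)
Definition laplace (s : C) : C :=
  cintegral m setT (fun w => (rho w)%:C * cexp (- (s * (L w)%:C))).

Definition laplace_cvg (a : R) :=
  m.-integrable setT (EFin \o (fun w => rho w * expR (- (a * L w)))).

Lemma normc_laplace_kernel (s : C) w :
  cnorm ((rho w)%:C * cexp (- (s * (L w)%:C))) = rho w * expR (- (RE s * L w)).
Proof.
rewrite Normc.normcM normc_real normc_cexp ger0_norm//.
by case: s => a b /=; rewrite mulr0 subr0.
Qed.

Lemma cmeasurable_laplace_kernel (s : C) :
  cmeasurable (fun w => (rho w)%:C * cexp (- (s * (L w)%:C))).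
Proof.
apply: cmeasurableM; first exact: cmeasurable_real.
have -> : (fun w => cexp (- (s * (L w)%:C))) = (fun w => cexp (- s * (L w)%:C)).
  by apply/funext => w; rewrite mulNr.
by apply/cmeasurable_cexp/cmeasurableM; [exact: cmeasurable_cst|exact: cmeasurable_real].
Qed.

Lemma cintegrable_laplace_kernel (s : C) : laplace_cvg (RE s) ->
  cintegrable m (fun w => (rho w)%:C * cexp (- (s * (L w)%:C))).
Proof.
move=> cv; apply: le_cintegrable cv; first exact: cmeasurable_laplace_kernel.
by move=> w; rewrite normc_laplace_kernel.
Qed.

Lemma integrable_shift (a v : R) : laplace_cvg a ->
  m.-integrable setT (EFin \o (fun w => rho w * expR (a * (v - L w)))).
Proof.
move=> cv; have := integrableZl measurableT (expR (a * v)) cv.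
apply: eq_integrable => // w _ /=; rewrite -EFinM; congr EFin.
by rewrite mulrBr expRD; ring.
Qed.

Definition laplace_joint (a v N : R) (z : measurableTypeR R * T) : C :=
  (triangle N z.1 * (rho z.2 * expR (a * (v - L z.2))))%:C *
  cexp (0 +i* (z.1 * (v - L z.2))).

Lemma cintegrable_laplace_joint (a v N : R) : 0 < N -> laplace_cvg a ->
  cintegrable (mu \x m)%E (laplace_joint a v N).
Proof.
move=> N0 cv.
have iprod := integrable_prod_fun (integrable_triangle N0) (integrable_shift v cv).
apply: (le_cintegrable (g := fun z : measurableTypeR R * T =>
  triangle N z.1 * (rho z.2 * expR (a * (v - L z.2))))) => //.
- apply: cmeasurableM.
    apply/cmeasurable_real/measurable_EFinP; exact: (measurable_int _ iprod).
  apply: cmeasurable_cexp; split => /=; first exact: measurable_cst.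
  apply: measurable_funM; first exact: measurable_fst.
  apply: measurable_funB => //.
  by apply: (measurableT_comp mL); exact: measurable_snd.
- move=> z; rewrite Normc.normcM normc_real normc_cexp expR0 mulr1 ger0_norm//.
  have /andP[k0 _] := triangle_ge0_le1 z.1 N0.
  by rewrite mulr_ge0// mulr_ge0// expR_ge0.
Qed.

(** The weight [triangle] makes the double integral absolutely convergent. After Fubini the integral
    over [t] is the Fourier transform of [triangle] at [v - L w], whose sine part vanishes by
    parity; hence a real value. *)
Lemma laplace_fejer (a v N : R) : 0 < N -> laplace_cvg a ->
  cintegral mu setT (fun t : R =>
     (triangle N t)%:C * (laplace (a +i* t) * cexp ((a +i* t) * v%:C))) =
  (\int[m]_w (rho w * expR (a * (v - L w)) * fejer N (v - L w)))%:C.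
Proof.
move=> N0 cv; have iJ := cintegrable_laplace_joint v N0 cv.
transitivity (cintegral mu setT (fun t : R => cintegral m setT (fun w => laplace_joint a v N (t, w)))).
  apply: eq_cintegral => t.
  rewrite mulrCA mulrC /laplace -cintegralZ; last first.
    exact: (cintegrable_laplace_kernel (s := a +i* t)).
  apply: eq_cintegral => w; rewrite /laplace_joint /=.
  have E : (expR (a * (v - L w)))%:C * cexp (0 +i* (t * (v - L w))) =
      cexp ((a +i* t) * v%:C) * cexp (- ((a +i* t) * (L w)%:C)).
    rewrite -cexp_real -!cexpD.
    by congr cexp; apply/eqP; rewrite eq_complex /=; apply/andP; split; apply/eqP; ring.
  rewrite (_ : (triangle N t * (rho w * expR (a * (v - L w))))%:C * _ =
      (triangle N t)%:C * (rho w)%:C *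
      ((expR (a * (v - L w)))%:C * cexp (0 +i* (t * (v - L w))))).
    rewrite E; move: (triangle N t) (cexp (_ * _)) (cexp (- _)) => k c1 c2; ring.
  by move: (triangle N t) (expR _) (cexp _) => k e c; rewrite !rmorphM/=; ring.
rewrite (cintegral_fubini1 iJ) -(cintegral_fubini2 iJ) -cintegral_real.
apply: eq_cintegral => w; rewrite /laplace_joint /=.
move: (v - L w) => u.
have mcs (f : R -> R) : continuous f ->
    measurable_fun [set: measurableTypeR R] (fun t : R => f (t * u)).
  move=> cf; apply: measurableT_comp; last exact: measurable_funM.
  exact: continuous_measurable_fun.
have ic := integrable_triangleM N0 (mcs _ (@continuous_cos R)) (fun t => cos_max _).
have is_ := integrable_triangleM N0 (mcs _ (@continuous_sin R)) (fun t => sin_max _).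
transitivity ((rho w * expR (a * u))%:C *
    cintegral mu setT (fun t : R => (triangle N t * cos (t * u)) +i* (triangle N t * sin (t * u)))).
  rewrite -cintegralZ; last by split.
  apply: eq_cintegral => t; rewrite /cexp /= expR0.
  by apply/eqP; rewrite eq_complex /=; apply/andP; split; apply/eqP; ring.
rewrite [RHS]rmorphM; congr (_ * _); rewrite /cintegral /=.
by rewrite integral_triangle_sin.
Qed.

(** Since [F] is absolutely integrable on the line and the weights lie in [[0, 1]] and tend to 1,
    dominated convergence removes them. *)
Lemma cvg_triangle_integral (a v : R) :
  cintegrable mu (fun t : R => laplace (a +i* t) * cexp ((a +i* t) * v%:C)) ->
  let F t := laplace (a +i* t) * cexp ((a +i* t) * v%:C) in
  (RE (cintegral mu setT (fun t : R => (triangle n.+1%:R t)%:C * F t))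
     @[n --> \oo] --> RE (cintegral mu setT F)) /\
  (IM (cintegral mu setT (fun t : R => (triangle n.+1%:R t)%:C * F t))
     @[n --> \oo] --> IM (cintegral mu setT F)).
Proof.
move=> iF F.
have mF := cintegrable_cmeasurable iF.
have inF := integrable_normc iF.
have mk n := cmeasurableM (cmeasurable_real (measurable_triangle n.+1%:R)) mF.
have kle n t : cnorm ((triangle n.+1%:R t)%:C * F t) <= cnorm (F t).
  have /andP[k0 k1] := @triangle_ge0_le1 R n.+1%:R t (ltr0Sn _ n).
  by rewrite Normc.normcM normc_real ger0_norm// ler_piMl// normc_ge0.
have ik n : cintegrable mu (fun t : R => (triangle n.+1%:R t)%:C * F t).
  by apply: le_cintegrable inF => // t; exact: kle.
have dct (P : C -> R) :
    (forall n, measurable_fun [set: measurableTypeR R] (fun t : R => P ((triangle n.+1%:R t)%:C * F t))) ->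
    (forall z, `|P z| <= cnorm z) ->
    (forall (k : R) z, P (k%:C * z) = k * P z) ->
    (forall n, mu.-integrable setT (EFin \o (fun t : R => P ((triangle n.+1%:R t)%:C * F t)))) ->
    mu.-integrable setT (EFin \o (fun t : R => P (F t))) ->
    \int[mu]_t P ((triangle n.+1%:R t)%:C * F t) @[n --> \oo] --> \int[mu]_t P (F t).
  move=> mP Pn Pk iP iPF.
  rewrite /Rintegral.
  apply: fine_cvg; rewrite fineK; last exact: (integrable_fin_num measurableT iPF).
  apply: (@dominated_cvg _ _ _ mu setT measurableT _ _ (EFin \o (fun t => cnorm (F t)))).
  - by move=> n; apply/measurable_EFinP; exact: mP.
  - move=> t _; apply: cvg_EFin; first exact: nearW.
    rewrite (_ : _ \o _ = (fun n : nat => triangle n.+1%:R t * P (F t))); last first.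
      by apply/funext => n /=; rewrite Pk.
    rewrite -[X in _ --> X](mul1r (P (F t))); apply: cvgM; first exact: cvg_triangle.
    exact: cvg_cst.
  - by [].
  - exact: inF.
  - by move=> n t _ /=; rewrite lee_fin (le_trans (Pn _)).
split.
- apply: dct.
  + by move=> n; have [] := mk n.
  + exact: normc_Re.
  + by move=> k [x y] /=; rewrite mul0r subr0.
  + by move=> n; have [] := ik n.
  + by case: iF.
- apply: dct.
  + by move=> n; have [] := mk n.
  + exact: normc_Im.
  + by move=> k [x y] /=; rewrite mul0r addr0.
  + by move=> n; have [] := ik n.
  + by case: iF.
Qed.

(** For [y <= x] the tangent inequality [e ^ (y - x) >= 1 + y - x] gives the bound with [e ^ x]
    alone; the sum makes it symmetric. *)
Lemma norm_expRB (x y : R) : `|expR x - expR y| <= `|x - y| * (expR x + expR y).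
Proof.
wlog xy : x y / y <= x => [H|].
  have [/H//|/ltW/H] := leP y x.
  by rewrite distrC [`|y - x|]distrC [expR y + _]addrC.
rewrite !ger0_norm ?subr_ge0 ?ler_expR//.
have e1 := expR_ge1Dx (y - x); have ex := expR_gt0 x; have ey := expR_gt0 y.
have E : expR y = expR x * expR (y - x) by rewrite -expRD addrC subrK.
have : expR x - expR y <= (x - y) * expR x by rewrite E; nra.
by move/le_trans; apply; rewrite ler_wpM2l ?subr_ge0// lerDl ltW.
Qed.

Lemma laplace_inversion_indep (a b v : R) :
  laplace_cvg a -> laplace_cvg b ->
  cintegrable mu (fun t : R => laplace (a +i* t) * cexp ((a +i* t) * v%:C)) ->
  cintegrable mu (fun t : R => laplace (b +i* t) * cexp ((b +i* t) * v%:C)) ->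
  cintegral mu setT (fun t : R => laplace (a +i* t) * cexp ((a +i* t) * v%:C)) =
  cintegral mu setT (fun t : R => laplace (b +i* t) * cexp ((b +i* t) * v%:C)) /\
  IM (cintegral mu setT (fun t : R => laplace (a +i* t) * cexp ((a +i* t) * v%:C))) = 0.
Proof.
have Im0 c : laplace_cvg c ->
    cintegrable mu (fun t : R => laplace (c +i* t) * cexp ((c +i* t) * v%:C)) ->
    IM (cintegral mu setT (fun t : R => laplace (c +i* t) * cexp ((c +i* t) * v%:C))) = 0.
  move=> cv ic; have [_ cvI] := cvg_triangle_integral ic.
  apply/esym; rewrite -(cvg_lim _ cvI)//; apply/esym/cvg_lim => //.
  rewrite (_ : (fun n : nat => _) = cst 0); first exact: cvg_cst.
  by apply/funext => n; rewrite laplace_fejer.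
move=> cva cvb ia ib; split; last exact: Im0.
have [cvRa _] := cvg_triangle_integral ia.
have [cvRb _] := cvg_triangle_integral ib.
move: cvRa cvRb (Im0 _ cva ia) (Im0 _ cvb ib).
set A := cintegral mu setT (fun t : R => laplace (a +i* t) * cexp ((a +i* t) * v%:C)).
set B := cintegral mu setT (fun t : R => laplace (b +i* t) * cexp ((b +i* t) * v%:C)).
pose I c n := RE (cintegral mu setT (fun t : R =>
  (triangle n.+1%:R t)%:C * (laplace (c +i* t) * cexp ((c +i* t) * v%:C)))).
rewrite -/(I a) -/(I b) => cvA cvB A0 B0.
have cvAB : (fun n => I a n - I b n) @ \oo --> RE A - RE B by exact: cvgB cvA cvB.
suff cvAB0 : (fun n => I a n - I b n) @ \oo --> (0 : R).
  have RAB : RE A - RE B = 0 by rewrite -(cvg_lim _ cvAB)//; apply/cvg_lim.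
  by apply/eqP; rewrite eq_complex A0 B0 eqxx andbT -subr_eq0 RAB.
have isa := integrable_shift v cva; have isb := integrable_shift v cvb.
have mu_v : measurable_fun setT (fun w => v - L w) by exact: measurable_funB.
pose h (n : nat) w := rho w * (expR (a * (v - L w)) - expR (b * (v - L w))) * fejer n.+1%:R (v - L w).
pose g w := 2 * (`|a - b| * (rho w * expR (a * (v - L w)) + rho w * expR (b * (v - L w)))).
have ig : m.-integrable setT (EFin \o g).
  exact: (integrableZl measurableT 2 (integrableZl measurableT `|a - b| (integrableD measurableT isa isb))).
have hg n w : `|h n w| <= g w.
  rewrite /h /g; move: (v - L w) => u.
  (* At [u = 0] the kernel is unbounded in [N], but there the two exponentials coincide and the
     difference is exactly 0. Elsewhere the factor [|u|] from the exponentials cancels the one in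
     [2 / |u|]. *)
  have [->|u0] := eqVneq u 0.
    by rewrite !mulr0 subrr mulr0 mul0r normr0 !mulr_ge0// addr_ge0// mulr_ge0// expR_ge0.
  rewrite normrM.
  have nu0 : 0 < `|u| by rewrite normr_gt0.
  apply: (@le_trans _ _ ((rho w * (`|a - b| * `|u| * (expR (a * u) + expR (b * u)))) * (2 / `|u|))).
    apply: ler_pM => //; last exact: normr_fejer_le.
    rewrite normrM ger0_norm// ler_wpM2l// (le_trans (norm_expRB _ _))//.
    by rewrite -mulrBl normrM.
  rewrite le_eqVlt; apply/orP; left; apply/eqP.
  by move: nu0; move: (`|u|) => x x0; field; rewrite gt_eqF.
have mfejer n := measurable_fejer (ltr0Sn R n).
have mh n : measurable_fun setT (h n).
  apply: measurable_funM; last exact: (measurableT_comp (mfejer n) mu_v).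
  apply: measurable_funM => //; apply: measurable_funB;
    by apply: measurableT_comp; [exact: measurable_expR|exact: measurable_funM].
have if_ c n : laplace_cvg c ->
    m.-integrable setT (EFin \o (fun w => rho w * expR (c * (v - L w)) * fejer n.+1%:R (v - L w))).
  move=> cvc; have isc := integrable_shift v cvc.
  have := integrableZl measurableT (\int[mu]_t triangle n.+1%:R t) isc.
  apply: le_integrable => //.
    apply/measurable_EFinP; apply: measurable_funM.
      by apply/measurable_EFinP; exact: (measurable_int m isc).
    exact: (measurableT_comp (mfejer n) mu_v).
  move=> w _ /=; rewrite lee_fin normrM mulrC [leRHS]normrM ler_wpM2r//.
  by apply: le_trans (ler_norm _); exact: normr_fejer_bound.
have hE n : I a n - I b n = \int[m]_w h n w.
  rewrite /I !laplace_fejer// -RintegralB//; try exact: if_.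
  by apply: eq_Rintegral => w _; rewrite /h; ring.
rewrite (_ : (fun n => _) = (fun n : nat => \int[m]_w h n w)); last exact/funext.
suff : \int[m]_w h n w @[n --> \oo] --> \int[m]_w (0 : R).
  by rewrite {2}/Rintegral integral0.
rewrite /Rintegral; apply: fine_cvg; rewrite fineK; last by rewrite integral0.
apply: (@dominated_cvg _ _ _ m setT measurableT _ _ (EFin \o g)) => //.
- by move=> n; apply/measurable_EFinP; exact: mh.
- move=> w _; apply: cvg_EFin; first exact: nearW.
  rewrite (_ : _ \o _ = (fun n : nat => h n w))//.
  rewrite /h; move: (v - L w) => u.
  have [->|u0] := eqVneq u 0.
    rewrite (_ : (fun n : nat => _) = cst 0); first exact: cvg_cst.
    by apply/funext => n; rewrite !mulr0 subrr mulr0 mul0r.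
  rewrite -[X in _ --> X](mulr0 (rho w * (expR (a * u) - expR (b * u)))).
  by apply: cvgM; [exact: cvg_cst|exact: cvg_fejer].
- by move=> n w _ /=; rewrite lee_fin.
Qed.

End Laplace.

Section LaplaceMeasurable.
Context {R : realType} d (T : measurableType d).
Variables (m : {sigma_finite_measure set T -> \bar R}) (rho L : T -> R).
Hypotheses (mrho : measurable_fun setT rho) (mL : measurable_fun setT L).
Hypothesis rho_ge0 : forall w, 0 <= rho w.

Lemma cmeasurable_laplace (a : R) : laplace_cvg m rho L a ->
  cmeasurable (fun t : measurableTypeR R => laplace m rho L (a +i* (t : R))).
Proof.
move=> cv.
have mF : cmeasurable (fun z : measurableTypeR R * T =>
    (rho z.2)%:C * cexp (- ((a +i* (z.1 : R)) * (L z.2)%:C))).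
  have mL2 : measurable_fun setT (fun z : measurableTypeR R * T => L z.2).
    by apply: (measurableT_comp mL); exact: measurable_snd.
  apply: cmeasurableM.
    by apply: cmeasurable_real; apply: (measurableT_comp mrho); exact: measurable_snd.
  have -> : (fun z : measurableTypeR R * T => cexp (- ((a +i* (z.1 : R)) * (L z.2)%:C))) =
      (fun z => cexp (-1 * ((a +i* (z.1 : R)) * (L z.2)%:C))).
    by apply/funext => z; rewrite mulN1r.
  apply: cmeasurable_cexp; apply: cmeasurableM; first exact: cmeasurable_cst.
  apply: cmeasurableM; last exact: cmeasurable_real.
  by split => /=; [exact: measurable_cst|exact: measurable_fst].
apply: (cmeasurable_cintegral (m := m) mF (g := fun w => rho w * expR (- (a * L w)))) => //.
by move=> t w; rewrite normc_laplace_kernel.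
Qed.

End LaplaceMeasurable.

Section ProductSigmaFinite.
Context {R : realType} d1 d2 (T1 : measurableType d1) (T2 : measurableType d2).
Variables (m1 : {sigma_finite_measure set T1 -> \bar R})
  (m2 : {sigma_finite_measure set T2 -> \bar R}).

(* A copy of [m1 \x m2] that can carry a sigma-finite instance. *)
Definition sf_prod := (m1 \x m2)%E.

HB.instance Definition _ := Measure.on sf_prod.

Let sf_prod_sigma_finite : sigma_finite setT sf_prod.
Proof.
have /sigma_finiteP[F [FT ndF Fm]] := sigma_finiteT m1.
have /sigma_finiteP[G [GT ndG Gm]] := sigma_finiteT m2.
exists (fun i => F i `*` G i).
  apply/esym; rewrite -subTset => -[x y] _.
  have [i _ Fi] : (\bigcup_i F i) x by rewrite -FT.
  have [j _ Gj] : (\bigcup_i G i) y by rewrite -GT.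
  exists (maxn i j) => //; split.
  - by move: Fi; exact/subsetPset/ndF/leq_maxl.
  - by move: Gj; exact/subsetPset/ndG/leq_maxr.
move=> i; have [mFi Fioo] := Fm i; have [mGi Gioo] := Gm i; split.
  exact: measurableX.
by rewrite /sf_prod product_measure1E// lte_mul_pinfty// ge0_fin_numE.
Qed.

HB.instance Definition _ := Measure_isSigmaFinite.Build _ _ _ sf_prod
  sf_prod_sigma_finite.

End ProductSigmaFinite.

Section LaplaceProduct.
Context {R : realType} d1 d2 (T1 : measurableType d1) (T2 : measurableType d2).
Variables (m1 : {sigma_finite_measure set T1 -> \bar R})
  (m2 : {sigma_finite_measure set T2 -> \bar R}).
Variables (rho1 L1 : T1 -> R) (rho2 L2 : T2 -> R).

Let rho12 (z : T1 * T2) := rho1 z.1 * rho2 z.2.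
Let L12 (z : T1 * T2) := L1 z.1 + L2 z.2.

Lemma laplace_cvg_prod (a : R) : laplace_cvg m1 rho1 L1 a -> laplace_cvg m2 rho2 L2 a ->
  laplace_cvg (sf_prod m1 m2) rho12 L12 a.
Proof.
move=> c1 c2; have := integrable_prod_fun c1 c2.
apply: eq_integrable => // z _ /=; congr EFin.
by rewrite /rho12 /L12 mulrDr opprD expRD; ring.
Qed.

Lemma laplace_prod (s : R[i]) :
  cintegrable m1 (fun w => (rho1 w)%:C * cexp (- (s * (L1 w)%:C))) ->
  cintegrable m2 (fun w => (rho2 w)%:C * cexp (- (s * (L2 w)%:C))) ->
  laplace (sf_prod m1 m2) rho12 L12 s = laplace m1 rho1 L1 s * laplace m2 rho2 L2 s.
Proof.
move=> i1 i2; rewrite /laplace -cintegral_prod_fun//; apply: eq_cintegral => z.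
rewrite /rho12 /L12 rmorphD/= mulrDr opprD cexpD.
by move: (cexp _) (cexp _) => e1 e2; rewrite rmorphM/=; ring.
Qed.

End LaplaceProduct.

(** * The Mellin-Barnes weight as a Laplace transform, and its integrability on lines *)

Section MellinBarnes.
Context {R : realType}.
Variables (alpha beta omega : R).
Local Notation C := R[i].
Local Notation mu := (@lebesgue_measure R).

Definition mellin_weight (s : C) : C :=
  Gamma (alpha%:C - s) * Gamma (beta%:C - s) * Gamma (omega%:C - s)
  / Gamma (omega%:C + 2^-1 - s).

Definition rbeta_kernel (y : R) : R :=
  \1_`]0, 1[%classic y * (expR ((omega - 1) * ln y) * expR ((2^-1 - 1) * ln (1 - y))).

Lemma rbeta_kernel_ge0 y : 0 <= rbeta_kernel y.
Proof. by rewrite mulr_ge0// mulr_ge0// expR_ge0. Qed.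

Lemma realC_half : (2^-1 : C) = (2^-1)%:C.
Proof. by rewrite fmorphV rmorph_nat. Qed.

(** The exponential is [y ^ (- s)], so it lowers the parameter [a] to [a - s]: this is how
    [Gamma (a - s)] becomes a Laplace transform in the variable [ln y]. *)
Lemma laplace_kernel_gamma (a : R) (s : C) (y : R) :
  (rgamma_kernel a y)%:C * cexp (- (s * (ln y)%:C)) = gamma_kernel (a%:C - s) y.
Proof.
rewrite /rgamma_kernel /gamma_kernel -mulNr -cpowE.
rewrite (_ : a%:C - s - 1 = (a%:C - 1) + - s); last by ring.
rewrite cpowD realC_sub1 cpow_real !rmorphM/=; ring.
Qed.

Lemma laplace_kernel_beta (s : C) (y : R) :
  (rbeta_kernel y)%:C * cexp (- (s * (ln y)%:C)) = beta_kernel (omega%:C - s) 2^-1 1 y.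
Proof.
rewrite /rbeta_kernel /beta_kernel -mulNr -cpowE.
rewrite (_ : omega%:C - s - 1 = (omega%:C - 1) + - s); last by ring.
rewrite realC_half !realC_sub1 cpowD !cpow_real !rmorphM/=; ring.
Qed.

Lemma measurable_rgamma_kernel a : measurable_fun [set: measurableTypeR R] (rgamma_kernel a : measurableTypeR R -> R).
Proof.
have [+ _] := @cmeasurable_gamma_kernel R a%:C.
by under eq_fun do rewrite gamma_kernel_real.
Qed.

Lemma measurable_rbeta_kernel : measurable_fun [set: measurableTypeR R] (rbeta_kernel : measurableTypeR R -> R).
Proof.
apply: measurable_funM; first exact: measurable_indic.
have ml : measurable_fun [set: measurableTypeR R] (fun y : R => ln (1 - y)).
  by apply: (measurableT_comp (@measurable_ln R)); exact: measurable_funB.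
have me c (f : measurableTypeR R -> R) : measurable_fun setT f ->
    measurable_fun setT (fun y => expR (c * f y)).
  move=> mf; apply: measurableT_comp; first exact: measurable_expR.
  exact: measurable_funM.
by apply: measurable_funM; apply: me => //; exact: measurable_ln.
Qed.

Lemma cvg_gamma (b a : R) : a < b -> laplace_cvg mu (rgamma_kernel b) (@ln R) a.
Proof.
move=> ab; have ba0 : 0 < b - a by rewrite subr_gt0.
apply: eq_integrable (integrable_rgamma_kernel ba0) => // y _ /=; congr EFin.
rewrite /rgamma_kernel (_ : (b - a - 1) * ln y = (b - 1) * ln y - a * ln y); last by ring.
by rewrite expRD; ring.
Qed.

Lemma half_gt0 : 0 < RE (2^-1 : C).
Proof. by rewrite realC_half /= invr_gt0. Qed.

Lemma RE_realB (a : R) (s : C) : RE (a%:C - s) = a - RE s.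
Proof. by case: s. Qed.

Lemma cvg_beta (a : R) : a < omega -> laplace_cvg mu rbeta_kernel (@ln R) a.
Proof.
move=> ao; have oa0 : 0 < RE (omega%:C - a%:C) by rewrite RE_realB subr_gt0.
have ib := integrable_normc (cintegrable_beta_kernel1 oa0 half_gt0).
apply: eq_integrable ib => // y _; rewrite /comp -laplace_kernel_beta normc_laplace_kernel//.
exact: rbeta_kernel_ge0.
Qed.

Definition mb_measure := sf_prod mu (sf_prod mu mu).
Definition mb_rho2 (z : measurableTypeR R * measurableTypeR R) : R :=
  rgamma_kernel beta z.1 * rbeta_kernel z.2.
Definition mb_L2 (z : measurableTypeR R * measurableTypeR R) : R :=
  ln (z.1 : R) + ln (z.2 : R).
Definition mb_rho (z : measurableTypeR R * (measurableTypeR R * measurableTypeR R)) : R :=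
  rgamma_kernel alpha z.1 * mb_rho2 z.2.
Definition mb_L (z : measurableTypeR R * (measurableTypeR R * measurableTypeR R)) : R :=
  ln (z.1 : R) + mb_L2 z.2.

Lemma mb_rho2_ge0 z : 0 <= mb_rho2 z.
Proof. by rewrite mulr_ge0 ?rgamma_kernel_ge0// rbeta_kernel_ge0. Qed.

Lemma measurable_mb_rho2 : measurable_fun setT mb_rho2.
Proof.
apply: measurable_funM.
  by apply: (measurableT_comp (measurable_rgamma_kernel beta)); exact: measurable_fst.
by apply: (measurableT_comp measurable_rbeta_kernel); exact: measurable_snd.
Qed.

Lemma measurable_mb_L2 : measurable_fun setT mb_L2.
Proof.
apply: measurable_funD; apply: (measurableT_comp (@measurable_ln R)).
  exact: measurable_fst.
exact: measurable_snd.
Qed.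

Lemma mb_rho_ge0 z : 0 <= mb_rho z.
Proof. by rewrite mulr_ge0 ?rgamma_kernel_ge0// mb_rho2_ge0. Qed.

Lemma measurable_mb_rho : measurable_fun setT mb_rho.
Proof.
apply: measurable_funM.
  by apply: (measurableT_comp (measurable_rgamma_kernel alpha)); exact: measurable_fst.
by apply: (measurableT_comp measurable_mb_rho2); exact: measurable_snd.
Qed.

Lemma measurable_mb_L : measurable_fun setT mb_L.
Proof.
apply: measurable_funD.
  by apply: (measurableT_comp (@measurable_ln R)); exact: measurable_fst.
by apply: (measurableT_comp measurable_mb_L2); exact: measurable_snd.
Qed.

Variable a : R.
Hypotheses (a_alpha : a < alpha) (a_beta : a < beta) (a_omega : a < omega).

Lemma mb_cvg2 : laplace_cvg (sf_prod mu mu) mb_rho2 mb_L2 a.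
Proof. exact: laplace_cvg_prod (cvg_gamma a_beta) (cvg_beta a_omega). Qed.

Lemma mb_cvg : laplace_cvg mb_measure mb_rho mb_L a.
Proof. exact: laplace_cvg_prod (cvg_gamma a_alpha) mb_cvg2. Qed.

Lemma mb_laplace (t : R) : laplace mb_measure mb_rho mb_L (a +i* t) =
  Gamma (alpha%:C - (a +i* t)) * Gamma (beta%:C - (a +i* t)) *
  Beta (omega%:C - (a +i* t)) 2^-1.
Proof.
set s := a +i* t.
have ra (b : R) : a < b -> 0 < RE (b%:C - s) by rewrite RE_realB subr_gt0.
have i1 (b : R) : a < b ->
    cintegrable mu (fun w : R => (rgamma_kernel b w)%:C * cexp (- (s * (ln w)%:C))).
  move=> ab; rewrite (funext (fun w => laplace_kernel_gamma b s w)).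
  exact/cintegrable_gamma_kernel/ra.
have i3 : cintegrable mu (fun w : R => (rbeta_kernel w)%:C * cexp (- (s * (ln w)%:C))).
  rewrite (funext (fun w => laplace_kernel_beta s w)).
  by apply: cintegrable_beta_kernel1; [exact: ra|exact: half_gt0].
have E1 (b : R) : a < b -> laplace mu (rgamma_kernel b) (@ln R) s = Gamma (b%:C - s).
  by move=> ab; rewrite GammaE ?ra//; apply: eq_cintegral => w; exact: laplace_kernel_gamma.
have E3 : laplace mu rbeta_kernel (@ln R) s = Beta (omega%:C - s) 2^-1.
  by apply: eq_cintegral => w; exact: laplace_kernel_beta.
have i23 : cintegrable (sf_prod mu mu)
    (fun w => (mb_rho2 w)%:C * cexp (- (s * (mb_L2 w)%:C))).
  exact: (cintegrable_laplace_kernel measurable_mb_rho2 measurable_mb_L2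
    mb_rho2_ge0 (s := s) mb_cvg2).
have E23 : laplace (sf_prod mu mu) mb_rho2 mb_L2 s =
    laplace mu (rgamma_kernel beta) (@ln R) s * laplace mu rbeta_kernel (@ln R) s.
  exact: laplace_prod (i1 _ a_beta) i3.
have -> : laplace mb_measure mb_rho mb_L s =
    laplace mu (rgamma_kernel alpha) (@ln R) s * laplace (sf_prod mu mu) mb_rho2 mb_L2 s.
  exact: laplace_prod (i1 _ a_alpha) i23.
by rewrite E23 !E1// E3 mulrA.
Qed.

(** The Beta relation with second parameter 1/2, divided by [Gamma (omega + 1/2 - s)]; the division
    is legitimate because Gamma does not vanish there. *)
Lemma mellin_weightE (t : R) : mellin_weight (a +i* t) =
  (Gamma 2^-1)^-1 * laplace mb_measure mb_rho mb_L (a +i* t).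
Proof.
rewrite mb_laplace /mellin_weight; set s := a +i* t.
have os0 : 0 < RE (omega%:C - s) by rewrite RE_realB subr_gt0.
have H := Gamma_Beta os0 half_gt0.
have -> : omega%:C + 2^-1 - s = omega%:C - s + 2^-1 by ring.
have n1 : Gamma (omega%:C - s + 2^-1) != 0.
  by apply: Gamma_neq0; rewrite RED addr_gt0 ?half_gt0.
have n2 := Gamma_neq0 half_gt0.
have EB : Beta (omega%:C - s) 2^-1 =
    Gamma (omega%:C - s) * Gamma 2^-1 / Gamma (omega%:C - s + 2^-1).
  by rewrite H mulfK.
rewrite EB; move: n1 n2; clear.
move: (Gamma (omega%:C - s + 2^-1)) (Gamma (omega%:C - s)) (Gamma 2^-1)
  (Gamma (alpha%:C - s)) (Gamma (beta%:C - s)) => p q r x y p0 r0.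
by field; rewrite p0 r0.
Qed.

Lemma cintegrable_mb_laplace :
  cintegrable mu (fun t : R => laplace mb_measure mb_rho mb_L (a +i* t)).
Proof.
have aa0 : 0 < alpha - a by rewrite subr_gt0.
have ab0 : 0 < beta - a by rewrite subr_gt0.
have ao0 : 0 < omega - a by rewrite subr_gt0.
pose KA := rGamma (alpha - a + 2) * Num.max 1 ((alpha - a) ^+ 2)^-1.
pose KB := rGamma (beta - a).
(* The modulus of the Beta integrand depends on [s] only through its real part, so its integral at
   the real point [a] bounds the whole line. *)
pose KO := \int[mu]_y cnorm (beta_kernel (omega%:C - a%:C) 2^-1 1 y).
have iK := integrableZl measurableT (KA * (KB * KO)) (@integrable_oneDsqrV R).
apply: le_cintegrable iK.
  apply: cmeasurable_laplace mb_cvg.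
  - exact: measurable_mb_rho.
  - exact: measurable_mb_L.
  - exact: mb_rho_ge0.
move=> t; rewrite mb_laplace; set s := a +i* t.
have sE (b : R) : b%:C - s = (b - a) +i* (- t).
  by apply/eqP; rewrite eq_complex /= sub0r !eqxx.
have hA := normc_Gamma_decay (- t) aa0.
have hB : cnorm (Gamma (beta%:C - s)) <= KB.
  apply: le_trans (normc_Gamma_le _) _; first by rewrite RE_realB subr_gt0.
  by rewrite RE_realB.
have hO : cnorm (Beta (omega%:C - s) 2^-1) <= KO.
  have is0 : 0 < RE (omega%:C - s) by rewrite RE_realB subr_gt0.
  apply: le_trans (le_normc_cintegral (cintegrable_beta_kernel1 is0 half_gt0)) _.
  rewrite le_eqVlt; apply/orP; left; apply/eqP; apply: eq_Rintegral => y _.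
  by rewrite -!laplace_kernel_beta !normc_laplace_kernel//; exact: rbeta_kernel_ge0.
rewrite sqrrN -sE in hA.
rewrite Normc.normcM [cnorm (_ * Gamma _)]Normc.normcM.
move: (normc_ge0 (Gamma (alpha%:C - s))) (normc_ge0 (Gamma (beta%:C - s)))
  (normc_ge0 (Beta (omega%:C - s) 2^-1)) hA hB hO; rewrite -/KA.
move: (cnorm _) (cnorm _) (cnorm _) => x y z x0 y0 z0 hx hy hz.
rewrite (_ : KA * (KB * KO) * _ = (KA * (1 + t ^+ 2)^-1) * KB * KO); last by ring.
by apply: ler_pM => //; [exact: mulr_ge0|exact: ler_pM].
Qed.

Lemma cintegrable_mellin_weight :
  cintegrable mu (fun t : R => mellin_weight (a +i* t)).
Proof.
under eq_fun do rewrite mellin_weightE.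
exact/cintegrableZ/cintegrable_mb_laplace.
Qed.

Lemma cintegrableM_cpow (F : R -> C) (x : R) : cintegrable mu F ->
  cintegrable mu (fun t : R => F t * cpow x (a +i* t)).
Proof.
move=> iF; have := integrableZl measurableT (expR (a * ln x)) (integrable_normc iF).
apply: le_cintegrable.
  apply: cmeasurableM; first exact: cintegrable_cmeasurable iF.
  by apply: cmeasurable_cpow => //; split => //=; exact: measurable_cst.
by move=> t /=; rewrite Normc.normcM normc_cpow mulrC.
Qed.

End MellinBarnes.

Section ContourShift.
Context {R : realType}.
Variables (alpha beta omega : R).
Local Notation C := R[i].
Local Notation mu := (@lebesgue_measure R).

(** This is [2 pi] times the inverse Mellin transform; the normalisation is restored by
    [coef2pi]. *)
Definition mellin_inverse (a x : R) : C :=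
  cintegral mu setT (fun t : R => mellin_weight alpha beta omega (a +i* t) * cpow x (a +i* t)).

(** Laplace inversion at [v = ln x]; the constant [1 / Gamma (1/2)] is real and so does not affect
    the vanishing of the imaginary part. *)
Lemma mellin_inverse_indep (a b x : R) :
  a < Num.min alpha (Num.min beta omega) -> b < Num.min alpha (Num.min beta omega) ->
  mellin_inverse a x = mellin_inverse b x /\ IM (mellin_inverse a x) = 0.
Proof.
rewrite !lt_min => /and3P[a1 a2 a3] /and3P[b1 b2 b3].
have ia := cintegrableM_cpow a x (cintegrable_mb_laplace a1 a2 a3).
have ib := cintegrableM_cpow b x (cintegrable_mb_laplace b1 b2 b3).
have E c : c < alpha -> c < beta -> c < omega -> mellin_inverse c x =
   (Gamma 2^-1)^-1 * cintegral mu setT (fun t : R =>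
      laplace mb_measure (mb_rho alpha beta omega) mb_L (c +i* t) * cexp ((c +i* t) * (ln x)%:C)).
  move=> c1 c2 c3; rewrite -cintegralZ; last first.
    have := cintegrableM_cpow c x (cintegrable_mb_laplace c1 c2 c3).
    by under eq_fun do rewrite cpowE.
  apply: eq_cintegral => t; rewrite mellin_weightE// cpowE mulrA//.
have {}ia : cintegrable mu (fun t : R =>
    laplace mb_measure (mb_rho alpha beta omega) mb_L (a +i* t) * cexp ((a +i* t) * (ln x)%:C)).
  by move: ia; under eq_fun do rewrite cpowE.
have {}ib : cintegrable mu (fun t : R =>
    laplace mb_measure (mb_rho alpha beta omega) mb_L (b +i* t) * cexp ((b +i* t) * (ln x)%:C)).
  by move: ib; under eq_fun do rewrite cpowE.
have [|||E1 E2] := laplace_inversion_indep _ _ _ (mb_cvg a1 a2 a3) (mb_cvg b1 b2 b3) ia ib.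
- exact: measurable_mb_rho.
- exact: measurable_mb_L.
- exact: mb_rho_ge0.
rewrite !E// E1; split=> //.
rewrite -E1 realC_half Gamma_real ?invr_gt0//.
rewrite -fmorphV; move: E2; move: (cintegral _ _ _) => [p q] /= ->.
by rewrite mulr0 mul0r addr0.
Qed.

End ContourShift.

(** * Dirichlet's integral *)

Section FubiniIntegrable.
Context {R : realType} d1 d2 (T1 : measurableType d1) (T2 : measurableType d2).
Variables (m1 : {sigma_finite_measure set T1 -> \bar R})
  (m2 : {sigma_finite_measure set T2 -> \bar R}).

Lemma cintegrable_fubini1 (F : T1 * T2 -> R[i]) : cintegrable (m1 \x m2)%E F ->
  cintegrable m1 (fun x => cintegral m2 setT (fun y => F (x, y))).
Proof.
have fin (f : T1 * T2 -> R) : (m1 \x m2)%E.-integrable setT (EFin \o f) ->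
    m1.-integrable setT (EFin \o (fun x => \int[m2]_y f (x, y))).
  move=> fi; have iF := integrable_fubini_F fi.
  apply: le_integrable iF => //.
    by apply/measurable_EFinP/measurableT_comp => //; exact: (measurable_fubini_F fi).
  (* Where the inner integral is infinite, [fine] gives 0, so passing to real values can only
     decrease the modulus. *)
  move=> x _ /=; rewrite /Rintegral /fubini_F /=.
  by case: (\int[m2]_y _)%E => [r| |] //=; rewrite normr0 leey.
by move=> [F1 F2]; split; [exact: (fin _ F1)|exact: (fin _ F2)].
Qed.

End FubiniIntegrable.

(** * Integrals over tuples by splitting off the first coordinate *)

Section TupleIntegral.
Context {R : realType}.
Local Notation C := R[i].
Local Notation mu := (@lebesgue_measure R).
Local Notation tuple n := (n.-tuple (measurableTypeR R)).

Section cons.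
Variable n : nat.
Local Notation pairing := (@cons_pair R n).

Let integrable_cons (f : tuple n.+1 -> R) : measurable_fun setT f ->
  (mu \x lebesgue_tuple n)%E.-integrable setT (EFin \o (f \o pairing)) ->
  (lebesgue_tuple n.+1).-integrable setT (EFin \o f) /\
  \int[lebesgue_tuple n.+1]_x f x = \int[(mu \x lebesgue_tuple n)%E]_p f (pairing p).
Proof.
move=> mf fi.
have mp := @measurable_cons_pair R n.
have mef : measurable_fun setT (EFin \o f) by exact/measurable_EFinP.
split.
  have := @integrable_pushforward _ _ _ _ R pairing mp (mu \x lebesgue_tuple n)%E setT (EFin \o f) mef.
  by rewrite preimage_setT => /(_ fi measurableT) /integrableP[h1 h2]; apply/integrableP; split.
have := @integral_pushforward _ _ _ _ R pairing mp (mu \x lebesgue_tuple n)%E setT (EFin \o f) mef.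
by rewrite preimage_setT => /(_ fi measurableT) H; rewrite /Rintegral; congr fine.
Qed.

Lemma cintegral_cons (F : tuple n.+1 -> C) : cmeasurable F ->
  cintegrable (mu \x lebesgue_tuple n)%E (fun p => F (pairing p)) ->
  cintegrable (lebesgue_tuple n.+1) F /\
  cintegral (lebesgue_tuple n.+1) setT F =
  cintegral (mu \x lebesgue_tuple n)%E setT (fun p => F (pairing p)).
Proof.
move=> [m1 m2] [i1 i2].
have [j1 e1] := integrable_cons m1 i1; have [j2 e2] := integrable_cons m2 i2.
by split; [split|rewrite /cintegral e1 e2].
Qed.

End cons.

Lemma cintegral_tuple0 (c : C) :
  cintegrable (lebesgue_tuple 0) (fun=> c) /\
  cintegral (lebesgue_tuple 0) setT (fun=> c) = c.
Proof.
have H (r : R) : (lebesgue_tuple 0).-integrable setT (EFin \o (fun=> r)) /\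
    \int[lebesgue_tuple 0]_(x in setT) r = r.
  have E (s : R) : (\int[lebesgue_tuple 0]_(x in setT) s%:E = s%:E)%E.
    rewrite [LHS](@integral_dirac _ (tuple 0) [tuple] R setT measurableT (fun=> s%:E))//.
    by rewrite diracT mul1e.
  split; last by rewrite /Rintegral E.
  apply/integrableP; split; first exact: measurable_cst.
  by rewrite (E `|r|) ltry.
have [i1 e1] := H (RE c); have [i2 e2] := H (IM c).
by split; [split|rewrite /cintegral e1 e2; case: c {i1 e1 i2 e2}].
Qed.

Lemma cmeasurable_tuple_prod n (F : 'I_n -> R -> C) :
  (forall i, cmeasurable (F i : measurableTypeR R -> C)) ->
  cmeasurable (fun t : tuple n => \prod_(i < n) F i (tnth t i)).
Proof.
move=> mF; apply: cmeasurable_prod => i.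
apply: (cmeasurable_comp (h := fun t : tuple n => (tnth t i : measurableTypeR R)) (mF i)).
exact: measurable_tnth.
Qed.

Lemma cintegral_tuple_prod n (F : 'I_n -> R -> C) :
  (forall i, cintegrable mu (F i)) ->
  cintegrable (lebesgue_tuple n) (fun t => \prod_(i < n) F i (tnth t i)) /\
  cintegral (lebesgue_tuple n) setT (fun t => \prod_(i < n) F i (tnth t i)) =
  \prod_(i < n) cintegral mu setT (F i).
Proof.
elim: n F => [|n IH] F iF.
  have [i0 e0] := cintegral_tuple0 1.
  rewrite (funext (fun t : tuple 0 => big_ord0 _ _ _ _ : \prod_(i < 0) F i (tnth t i) = 1)).
  by rewrite big_ord0.
have mF := cmeasurable_tuple_prod (fun i => cintegrable_cmeasurable (iF i)).
have [i1 e1] := IH (fun i => F (lift ord0 i)) (fun i => iF (lift ord0 i)).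
have E p : \prod_(i < n.+1) F i (tnth (cons_pair p) i) =
    F ord0 p.1 * \prod_(i < n) F (lift ord0 i) (tnth p.2 i).
  rewrite big_ord_recl; congr (_ * _).
  by apply: eq_bigr => i _; rewrite tnthS.
have iE : cintegrable (mu \x lebesgue_tuple n)%E
    (fun p => \prod_(i < n.+1) F i (tnth (cons_pair p) i)).
  by rewrite (funext E); exact: (cintegrable_prod_fun (iF ord0) i1).
have [i2 e2] := cintegral_cons mF iE.
split=> //; rewrite e2 (funext E).
rewrite [LHS](cintegral_prod_fun (iF ord0) i1) e1.
by rewrite big_ord_recl.
Qed.

End TupleIntegral.

Section Dirichlet.
Context {R : realType}.
Local Notation C := R[i].
Local Notation mu := (@lebesgue_measure R).
Local Notation tuple n := (n.-tuple (measurableTypeR R)).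

(** Meant for the induction on the simplex: when the first coordinate equals [r], the remaining
    simplex has size 0 and the induction hypothesis does not apply. *)
Lemma eq_cintegral_except (F G : measurableTypeR R -> C) (r : R) :
  cmeasurable F -> cmeasurable G -> (forall x, x != r -> F x = G x) ->
  cintegral mu setT F = cintegral mu setT G.
Proof.
move=> [f1 f2] [g1 g2] FG.
have H (f g : measurableTypeR R -> R) : measurable_fun setT f -> measurable_fun setT g ->
    (forall x, x != r -> f x = g x) -> \int[mu]_x f x = \int[mu]_x g x.
  move=> mf mg fg; rewrite /Rintegral; congr fine; apply: ae_eq_integral => //.
  - exact/measurable_EFinP.
  - exact/measurable_EFinP.
  - exists [set r]; split; [exact: measurable_set1|exact: lebesgue_measure_set1|].
    move=> x /= /not_implyP[_ h]; apply: contrapT => /eqP xr; apply: h.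
    by rewrite fg.
by rewrite /cintegral; congr (_ +i* _); apply: H => // x /FG ->.
Qed.

Definition power_kernel (z : C) (x : R) : C :=
  (\1_`]0, +oo[%classic x)%:C * cpow x (z - 1).

(* [b] decides whether the boundary of the simplex is included. *)
Definition dirichlet_kernel n (b : bool) (r : R) (z : 'I_n -> C) (x : tuple n) : C :=
  (\1_[set` Interval -oo%O (BSide (~~ b) r)] (\sum_(m < n) (tnth x m : R)))%:C *
  \prod_(m < n) power_kernel (z m) (tnth x m).

Lemma cmeasurable_power_kernel (z : C) :
  cmeasurable (power_kernel z : measurableTypeR R -> C).
Proof.
apply: cmeasurableM; first by apply: cmeasurable_real; exact: measurable_indic.
by apply: cmeasurable_cpow => //; exact: cmeasurable_cst.
Qed.

Lemma measurable_tuple_sum n :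
  measurable_fun setT (fun x : tuple n => \sum_(m < n) (tnth x m : R)).
Proof. by apply: measurable_sum => m; exact: measurable_tnth. Qed.

Lemma measurable_simplex n b (r : R) :
  measurable_fun setT (fun x : tuple n =>
    \1_[set` Interval -oo%O (BSide b r)] (\sum_(m < n) (tnth x m : R)) : R).
Proof.
have mi : measurable_fun [set: measurableTypeR R]
    (\1_[set` Interval -oo%O (BSide b r)] : measurableTypeR R -> R).
  exact: measurable_indic.
exact: (measurableT_comp mi (@measurable_tuple_sum n)).
Qed.

Lemma cmeasurable_dirichlet_kernel n b r (z : 'I_n -> C) :
  cmeasurable (dirichlet_kernel b r z).
Proof.
apply: cmeasurableM; first by apply: cmeasurable_real; exact: measurable_simplex.
exact: (cmeasurable_tuple_prod (fun m => cmeasurable_power_kernel (z m))).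
Qed.

Lemma normc_power_kernel (z : C) (x : R) :
  cnorm (power_kernel z x) = rgamma_kernel (RE z) x * expR x.
Proof.
rewrite /power_kernel Normc.normcM normc_real normc_cpow RE_sub1 /rgamma_kernel.
by rewrite ger0_norm// -!mulrA -[expR (- x) * _]expRD addNr expR0 mulr1.
Qed.

(** On the simplex [1 <= e ^ r e ^ (- sum x)], and distributing the exponential over the coordinates
    turns powers into Gamma integrands. The bound depends on [z] only through its real parts. *)
Lemma normc_dirichlet_kernel_le n b r (z : 'I_n -> C) (x : tuple n) :
  cnorm (dirichlet_kernel b r z x) <=
  expR r * cnorm (\prod_(m < n) gamma_kernel (z m) (tnth x m)).
Proof.
rewrite /dirichlet_kernel Normc.normcM normc_real !normc_prod indicE mem_setE in_itv/=.
have [xr|_] := boolP (_ < _ ?<= if _); last first.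
  by rewrite normr0 mul0r mulr_ge0 ?expR_ge0// prodr_ge0// => i _; exact: normc_ge0.
rewrite normr1 mul1r.
rewrite (eq_bigr _ (fun m _ => normc_power_kernel (z m) (tnth x m))).
rewrite [X in _ <= _ * X](eq_bigr _ (fun m _ => normc_gamma_kernel (z m) (tnth x m))).
rewrite big_split /= mulrC ler_wpM2r//.
  by apply: prodr_ge0 => i _; exact: rgamma_kernel_ge0.
by rewrite -expR_sum ler_expR (lteifW xr).
Qed.

Lemma cintegrable_dirichlet_kernel n b r (z : 'I_n -> C) :
  (forall m, 0 < RE (z m)) -> cintegrable (lebesgue_tuple n) (dirichlet_kernel b r z).
Proof.
move=> z0; have [ig _] := cintegral_tuple_prod (fun m => cintegrable_gamma_kernel (z0 m)).
apply: le_cintegrable (integrableZl measurableT (expR r) (integrable_normc ig)).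
  exact: cmeasurable_dirichlet_kernel.
exact: normc_dirichlet_kernel_le.
Qed.

Lemma dirichlet_kernel_lt0 n b (r : R) (z : 'I_n -> C) x : r < 0 ->
  dirichlet_kernel b r z x = 0.
Proof.
move=> r0; rewrite /dirichlet_kernel indicE mem_setE in_itv/=.
have [[m xm]|xpos] := pselect (exists m, tnth x m <= 0).
  rewrite [X in _ * X](bigD1 m)//= /power_kernel indic_pos ltNge xm.
  by rewrite !mul0r mulr0.
rewrite (_ : (_ < _ ?<= if _) = false) ?mul0r//.
apply/negP => /lteifW; apply/negP; rewrite -ltNge (lt_le_trans r0)//.
apply: sumr_ge0 => m _; rewrite leNgt; apply/negP => /ltW xm.
by apply: xpos; exists m.
Qed.

Lemma dirichlet_kernel_cons n b r (z : 'I_n.+1 -> C) (p : measurableTypeR R * tuple n) :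
  dirichlet_kernel b r z (cons_pair p) =
  power_kernel (z ord0) p.1 *
  dirichlet_kernel b (r - p.1) (fun m => z (lift ord0 m)) p.2.
Proof.
rewrite /dirichlet_kernel !big_ord_recl.
have -> : \sum_(i < n) (tnth (cons_pair p) (lift ord0 i) : R) = \sum_(i < n) (tnth p.2 i : R).
  by apply: eq_bigr => i _; rewrite tnthS.
have -> : \prod_(i < n) power_kernel (z (lift ord0 i)) (tnth (cons_pair p) (lift ord0 i)) =
    \prod_(i < n) power_kernel (z (lift ord0 i)) (tnth p.2 i).
  by apply: eq_bigr => i _; rewrite tnthS.
have -> : tnth (cons_pair p) ord0 = p.1 by [].
rewrite !indicE !mem_setE !in_itv/= lteifBrDl.
by rewrite mulrCA.
Qed.

(** Induction on the first coordinate [x]: the others contribute a constant times [(r - x) ^ S] by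
    scaling, which leaves a Beta integral with parameters [z ord0] and [1 + S]. Its factor
    [Gamma (1 + S)] cancels the denominator of the induction hypothesis. *)
Lemma dirichlet_integral n b (r : R) (z : 'I_n -> C) : 0 < r ->
  (forall m, 0 < RE (z m)) ->
  cintegral (lebesgue_tuple n) setT (dirichlet_kernel b r z) =
  cpow r (\sum_(m < n) z m) * (\prod_(m < n) Gamma (z m)) / Gamma (1 + \sum_(m < n) z m).
Proof.
elim: n r z => [|n IH] r z r0 z0.
  rewrite !big_ord0 cpow0 addr0 Gamma1 divr1 mulr1 -[RHS](cintegral_tuple0 1).2.
  apply: eq_cintegral => x; rewrite /dirichlet_kernel !big_ord0 indicE mem_setE in_itv/=.
  by rewrite mulr1; case: b; rewrite /= ?(ltW r0) ?r0.
pose z' m := z (lift ord0 m).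
have z'0 m : 0 < RE (z' m) by exact: z0.
have iz := cintegrable_dirichlet_kernel b r z0.
have mF := @cmeasurable_dirichlet_kernel _ b r z.
have iF : cintegrable (mu \x lebesgue_tuple n)%E (fun p => dirichlet_kernel b r z (cons_pair p)).
  have [ig _] := cintegral_tuple_prod (fun m => cintegrable_gamma_kernel (z'0 m)).
  have ig2 := integrable_normc (cintegrable_prod_fun (cintegrable_gamma_kernel (z0 ord0)) ig).
  apply: le_cintegrable (integrableZl measurableT (expR r) ig2).
    by apply: cmeasurable_comp mF _; exact: measurable_cons_pair.
  move=> p; apply: le_trans (normc_dirichlet_kernel_le _ _ _ _) _.
  rewrite ler_wpM2l ?expR_ge0// big_ord_recl.
  by under eq_bigr do rewrite tnthS.
have [_ ->] := cintegral_cons mF iF.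
rewrite -(cintegral_fubini1 iF).
set S := \sum_(m < n) z' m.
have S0 : 0 <= RE S.
  by rewrite /S; elim/big_ind : _ => // [x y|m _]; [rewrite RED; exact: addr_ge0|exact: ltW].
have S1 : 0 < RE (1 + S) by rewrite RED ltr_pwDl.
pose c := (\prod_(m < n) Gamma (z' m)) / Gamma (1 + S).
transitivity (cintegral mu setT (fun x => c * beta_kernel (z ord0) (1 + S) r x)).
  apply: (@eq_cintegral_except _ _ r).
  - exact: cintegrable_cmeasurable (cintegrable_fubini1 iF).
  - by apply: cmeasurableM; [exact: cmeasurable_cst|exact: cmeasurable_beta_kernel].
  - move=> x xr.
    have -> : cintegral (lebesgue_tuple n) setT (fun y => dirichlet_kernel b r z (cons_pair (x, y))) =
        power_kernel (z ord0) x * cintegral (lebesgue_tuple n) setT (dirichlet_kernel b (r - x) z').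
      rewrite -cintegralZ; last exact: cintegrable_dirichlet_kernel.
      by apply: eq_cintegral => y; rewrite dirichlet_kernel_cons.
    rewrite /power_kernel /beta_kernel indic_pos indicE mem_setE in_itv/=.
    have [x0|_] := ltP 0 x; last by rewrite !mul0r mulr0.
    have [rx|rx|rx] := ltgtP x r.
    + rewrite IH ?subr_gt0// -/S !mul1r /c.
      by rewrite (_ : 1 + S - 1 = S); [ring|ring].
    + have rx0 : r - x < 0 by rewrite subr_lt0.
      have -> : cintegral (lebesgue_tuple n) setT (dirichlet_kernel b (r - x) z') = 0.
        transitivity (cintegral (lebesgue_tuple n) setT (fun=> (0 : R)%:C)).
          by apply: eq_cintegral => y; rewrite dirichlet_kernel_lt0.
        by rewrite cintegral_real /Rintegral integral0.
      by rewrite mulr0 mul0r mulr0.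
    + by rewrite rx eqxx in xr.
rewrite cintegralZ; last exact: cintegrable_beta_kernel.
rewrite cintegral_beta_kernel// !big_ord_recl -/S.
have zS : z ord0 + (1 + S) = 1 + (z ord0 + S) by ring.
have n1 := Gamma_neq0 S1.
have n2 : Gamma (1 + (z ord0 + S)) != 0.
  by apply: Gamma_neq0; rewrite -zS RED addr_gt0.
have EB : Beta (z ord0) (1 + S) = Gamma (z ord0) * Gamma (1 + S) / Gamma (1 + (z ord0 + S)).
  by rewrite (Gamma_Beta (z0 ord0) S1) zS mulfK.
rewrite EB /c zS (_ : 1 + (z ord0 + S) - 1 = z ord0 + S); last by ring.
by field; rewrite n1 n2.
Qed.

End Dirichlet.

(** * The outage probability *)

Section OutageProbability.
Context {R : realType}.
Local Notation C := R[i].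
Local Notation mu := (@lebesgue_measure R).
Local Notation tuple n := (n.-tuple (measurableTypeR R)).

Lemma cpow_sum (x : R) n (z : 'I_n -> C) :
  cpow x (\sum_(m < n) z m) = \prod_(m < n) cpow x (z m).
Proof. by rewrite (big_morph _ (cpowD x) (cpow0 x)). Qed.

Lemma cpow_sqrt (x : R) (s : C) : 0 < x -> cpow (Num.sqrt x) s = cpow x (s / 2).
Proof.
move=> x0; have sx0 : 0 < Num.sqrt x by rewrite sqrtr_gt0.
rewrite -{2}(sqr_sqrtr (ltW x0)) expr2 cpowM// -cpowD; congr cpow.
by field.
Qed.

Lemma RE_half (s : C) : RE (s / 2) = RE s / 2.
Proof. by rewrite realC_half; case: s => a b /=; rewrite mulr0 subr0. Qed.

Variables (alpha beta omega A0 hl gbar : R).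
Hypotheses (alpha_gt0 : 0 < alpha) (beta_gt0 : 0 < beta)
  (A0_gt0 : 0 < A0) (hl_gt0 : 0 < hl) (gbar_gt0 : 0 < gbar).

Let kappa := alpha * beta / (A0 * hl).

Let kappa_gt0 : 0 < kappa.
Proof. by rewrite divr_gt0// mulr_gt0. Qed.

(** Separates the variable of integration from the constants. The square root halves the exponent,
    whence the [s / 2] in the H-function. Used again backwards at [x = thr]. *)
Lemma cpow_snr (x : R) (s : C) : 0 < x ->
  cpow (kappa * Num.sqrt (x / gbar)) s =
  cpow (kappa / Num.sqrt gbar) s * cpow x (s / 2).
Proof.
move=> x0; have sg0 : 0 < Num.sqrt gbar by rewrite sqrtr_gt0.
have sx0 : 0 < Num.sqrt x by rewrite sqrtr_gt0.
rewrite -(cpow_sqrt s x0) -(cpowM s _ sx0); last exact: divr_gt0.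
have -> : Num.sqrt (x / gbar) = Num.sqrt x / Num.sqrt gbar.
  by rewrite sqrtrM ?(ltW x0)// sqrtrV ?(ltW gbar_gt0).
by rewrite mulrCA mulrC.
Qed.

Let coef : C := (Num.sqrt omega)%:C / (2 * Gamma alpha%:C * Gamma beta%:C).
Let coef2pi : C := coef * ((2 * pi)^-1)%:C.

(** Moves the density from its own line to the line [sigma] chosen for one variable of the
    H-function, and drops the real part because the contour integral is real. *)
Lemma snr_densityE (sigmaG sigma x : R) : 0 < x ->
  sigmaG < Num.min alpha (Num.min beta omega) ->
  sigma < Num.min alpha (Num.min beta omega) ->
  (snr_density sigmaG alpha beta omega A0 hl gbar x)%:C =
  coef2pi * ((x^-1)%:C *
    mellin_inverse alpha beta omega sigma (kappa * Num.sqrt (x / gbar))).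
Proof.
move=> x0 sG s1; have [-> _] := mellin_inverse_indep (kappa * Num.sqrt (x / gbar)) s1 sG.
have [_ I0] := mellin_inverse_indep (kappa * Num.sqrt (x / gbar)) sG sG.
set J := mellin_inverse _ _ _ _ _ in I0 *.
have JE : J = (RE J)%:C by move: I0; case: (J) => p q /= ->.
have pi0 : pi != 0 :> R by rewrite gt_eqF// pi_gt0.
have i0 : 'i%C != 0 :> C by rewrite eq_complex /= oner_eq0 andbF.
have ME : meijerG3013 sigmaG (omega + 2^-1) alpha beta omega (kappa * Num.sqrt (x / gbar)) =
    ((2 * pi)^-1)%:C * J.
  rewrite /meijerG3013 /vline_integral /twopii.
  have -> : cintegral mu setT (fun t : R =>
     Gamma (alpha%:C - (sigmaG +i* t)) * Gamma (beta%:C - (sigmaG +i* t)) *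
     Gamma (omega%:C - (sigmaG +i* t)) / Gamma ((omega + 2^-1)%:C - (sigmaG +i* t)) *
     cpow (kappa * Num.sqrt (x / gbar)) (sigmaG +i* t)) = J.
    by apply: eq_cintegral => t; rewrite /mellin_weight realC_half -rmorphD.
  rewrite invfM mulrA -[_ * _ * 'i%C]mulrA mulVf// mulr1; congr (_ * _).
  by rewrite -fmorphV.
rewrite /snr_density -/kappa ME JE /coef2pi /coef !Gamma_real//.
rewrite (_ : (2 : C) = (2 : R)%:C); last by rewrite rmorph_nat.
rewrite -!rmorphM -!fmorphV -!rmorphM /=; congr (_%:C).

have a1 := rGamma_gt0 alpha_gt0; have b1 := rGamma_gt0 beta_gt0.
clear ME JE; move: (@pi R) pi0 => q q0.
by field; rewrite q0 !gt_eqF.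
Qed.

Variables (M : nat) (sigmaG : R) (sigma : 'I_M -> R).
Hypothesis sigmaG_lt : sigmaG < Num.min alpha (Num.min beta omega).
Hypothesis sigma_in : forall m, 0 < sigma m < Num.min alpha (Num.min beta omega).
Variables (thr : R).
Hypothesis thr_gt0 : 0 < thr.

Let line (t : tuple M) (m : 'I_M) : C := sigma m +i* (tnth t m : R).
Let weight (t : tuple M) : C := \prod_(m < M)
  (mellin_weight alpha beta omega (line t m) * cpow (kappa / Num.sqrt gbar) (line t m)).

(** The joint integrand: the first component holds the SNRs, the second the heights on the vertical
    lines. Integrating out the second gives the product density cut to the simplex, integrating out
    the first gives Dirichlet's formula. *)
Let W b (p : tuple M * tuple M) : C :=
  weight p.2 * dirichlet_kernel b thr (fun m => line p.2 m / 2) p.1.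

Let cintegrable_factor m (y : R) :
  cintegrable mu (fun t : R => mellin_weight alpha beta omega (sigma m +i* t) * cpow y (sigma m +i* t)).
Proof.
have := sigma_in m; rewrite !lt_min => /andP[_ /and3P[h1 h2 h3]].
exact/cintegrableM_cpow/cintegrable_mellin_weight.
Qed.

Let cintegrable_weight : cintegrable (lebesgue_tuple M) weight.
Proof. by have [] := cintegral_tuple_prod (fun m => cintegrable_factor m (kappa / Num.sqrt gbar)). Qed.

Let RE_line t m : RE (line t m / 2) = sigma m / 2.
Proof. by rewrite RE_half. Qed.

Let RE_line_gt0 t m : 0 < RE (line t m / 2).
Proof. by rewrite RE_line divr_gt0//; case/andP: (sigma_in m). Qed.

(** The majorant is a product of a function of each component: the simplex part is bounded by Gamma
    integrands at the real parameters [sigma m / 2], whatever the heights. *)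
Let cintegrable_W b : cintegrable (lebesgue_tuple M \x lebesgue_tuple M)%E (W b).
Proof.
have s0 m : 0 < RE ((sigma m / 2)%:C : C) by rewrite /= divr_gt0//; case/andP: (sigma_in m).
have [ig _] := cintegral_tuple_prod (fun m => cintegrable_gamma_kernel (s0 m)).
have iB := integrable_prod_fun
  (integrableZl measurableT (expR thr) (integrable_normc ig)) (integrable_normc cintegrable_weight).
apply: le_cintegrable iB.
- apply: cmeasurableM.
    by apply: cmeasurable_comp (cintegrable_cmeasurable cintegrable_weight) _; exact: measurable_snd.
  have mtn1 m : measurable_fun setT (fun p : tuple M * tuple M => (tnth p.1 m : measurableTypeR R)).
    by apply: (measurableT_comp (measurable_tnth m)); exact: measurable_fst.
  have mtn2 m : measurable_fun setT (fun p : tuple M * tuple M => (tnth p.2 m : measurableTypeR R)).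
    by apply: (measurableT_comp (measurable_tnth m)); exact: measurable_snd.
  apply: cmeasurableM.
    by apply: cmeasurable_real; apply: (measurableT_comp (@measurable_simplex R M _ _)); exact: measurable_fst.
  apply: cmeasurable_prod => m; apply: cmeasurableM.
    apply: cmeasurable_real.
    have mi : measurable_fun [set: measurableTypeR R] (\1_`]0%R, +oo[ : measurableTypeR R -> R).
      exact: measurable_indic.
    exact: (measurableT_comp mi (mtn1 m)).
  apply: cmeasurable_cpow; first exact: mtn1.
  apply: cmeasurableD; last exact: cmeasurable_cst.
  apply: cmeasurableM; last exact: cmeasurable_cst.
  by split => /=; [exact: measurable_cst|exact: mtn2].
- move=> [x t]; rewrite /W Normc.normcM mulrC /=.
  apply: ler_wpM2r; first exact: normc_ge0.
  apply: le_trans (normc_dirichlet_kernel_le _ _ _ _) _.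
  rewrite ler_wpM2l ?expR_ge0// !normc_prod.
  rewrite (eq_bigr _ (fun m _ => normc_gamma_kernel (line t m / 2) (tnth x m))).
  rewrite [leRHS](eq_bigr _ (fun m _ => normc_gamma_kernel (sigma m / 2)%:C (tnth x m))).
  by under eq_bigr do rewrite RE_line.
Qed.

Let f := snr_density sigmaG alpha beta omega A0 hl gbar.

Let prod_density b (x : tuple M) :
  (\1_(@positive_orthant R M `&` [set x | \sum_(m < M) (tnth x m : R) < thr ?<= if b]) x)%:C *
    (\prod_(m < M) f (tnth x m))%:C =
  coef2pi ^+ M * cintegral (lebesgue_tuple M) setT (fun t => W b (x, t)).
Proof.
rewrite indicE; case: (boolP (x \in _)) => [/set_mem[xpos xs]|xn].
  rewrite mul1r.
  transitivity (\prod_(m < M) (coef2pi * (((tnth x m : R)^-1)%:C *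
      mellin_inverse alpha beta omega (sigma m) (kappa * Num.sqrt (tnth x m / gbar))))).
    rewrite rmorph_prod; apply: eq_bigr => m _.
    exact: snr_densityE (xpos m) sigmaG_lt (proj2 (andP (sigma_in m))).
  rewrite big_split /= prodr_const card_ord; congr (_ * _).
  have iF m : cintegrable mu (fun t : R => ((tnth x m : R)^-1)%:C *
      (mellin_weight alpha beta omega (sigma m +i* t) *
       cpow (kappa * Num.sqrt (tnth x m / gbar)) (sigma m +i* t))).
    exact/cintegrableZ/cintegrable_factor.
  have [_ E] := cintegral_tuple_prod iF.
  transitivity (\prod_(m < M) cintegral mu setT (fun t : R => ((tnth x m : R)^-1)%:C *
      (mellin_weight alpha beta omega (sigma m +i* t) *
       cpow (kappa * Num.sqrt (tnth x m / gbar)) (sigma m +i* t)))).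
    apply: eq_bigr => m _; rewrite cintegralZ//; exact: cintegrable_factor.
  rewrite -E; apply: eq_cintegral => t.
  rewrite /W /weight /dirichlet_kernel indicE mem_setE in_itv/= negbK xs mul1r -big_split /=.
  apply: eq_bigr => m _; rewrite -/(line t m).
  have x0 : 0 < (tnth x m : R) := xpos m.
  rewrite /power_kernel indic_pos x0 mul1r cpow_snr//.
  rewrite cpowD (_ : cpow (tnth x m) (- 1) = ((tnth x m : R)^-1)%:C); first by ring.
  rewrite -(rmorph1 (real_complex R)) -rmorphN cpow_real mulN1r expRN lnK//.
(* Outside the region [W] vanishes too: either some coordinate is not positive and its power kernel
   is 0, or the bound on the sum fails. *)
rewrite mul0r -[LHS](mulr0 (coef2pi ^+ M)); congr (_ * _).
transitivity (cintegral (lebesgue_tuple M) setT (fun=> (0 : R)%:C)).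
  by rewrite cintegral_real /Rintegral integral0.
apply: eq_cintegral => t; rewrite /W /dirichlet_kernel /=.
have [/existsP[m xm]|/existsPn xpos] := boolP [exists m, (tnth x m : R) <= 0].
  rewrite [X in _ * (_ * X)](bigD1 m)//= /power_kernel indic_pos ltNge xm.
  by rewrite !mul0r !mulr0.
rewrite indicE mem_setE in_itv/= negbK (_ : (_ < _ ?<= if b) = false) ?mul0r ?mulr0//.
apply: contraNF xn => xs; apply/mem_set; split=> // m.
by rewrite ltNge.
Qed.

(** Fubini for [W]. The value does not depend on [b], so strict and large inequalities receive the
    same probability. *)
Lemma joint_prob_foxH b : exists p : R,
  joint_prob f [set x : tuple M | \sum_(m < M) (tnth x m : R) < thr ?<= if b] = p%:E /\
  p%:C = coef ^+ M * foxH sigma alpha beta omega (fun=> kappa * Num.sqrt (thr / gbar)).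
Proof.
set S := (X in joint_prob f X).
have iW := cintegrable_W b.
have iG := cintegrableZ (coef2pi ^+ M) (cintegrable_fubini1 iW).
pose g x := \1_(@positive_orthant R M `&` S) x * \prod_(m < M) f (tnth x m).
have gE x : (g x)%:C = coef2pi ^+ M * cintegral (lebesgue_tuple M) setT (fun t => W b (x, t)).
  by rewrite -prod_density rmorphM.
have ig : (lebesgue_tuple M).-integrable setT (EFin \o g).
  have [+ _] := iG; apply: eq_integrable => // x _ /=.
  by rewrite -[in LHS]gE.
exists (\int[lebesgue_tuple M]_x g x); split.
  rewrite /joint_prob integral_mkcond /Rintegral fineK; last exact: (integrable_fin_num measurableT ig).
  apply: eq_integral => x _; rewrite patchE /g indicE; case: ifPn => _; rewrite ?mul1r//.
  by rewrite mul0r.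
rewrite -cintegral_real; under eq_cintegral do rewrite gE.
rewrite cintegralZ; last exact: cintegrable_fubini1 iW.
rewrite (cintegral_fubini1 iW) -(cintegral_fubini2 iW).
have pi0 : pi != 0 :> R by rewrite gt_eqF// pi_gt0.
have i0 : 'i%C != 0 :> C by rewrite eq_complex /= oner_eq0 andbF.
(* Each [ds] contributes a factor [i], which reduces [1 / (2 pi i)] to the real constant
   [1 / (2 pi)]. *)
have cE : coef2pi ^+ M = coef ^+ M * ((twopii ^+ M)^-1 * 'i%C ^+ M).
  have E : ((2 * pi)^-1)%:C = twopii^-1 * 'i%C :> C.
    by rewrite /twopii [in RHS]invfM -[RHS]mulrA mulVf// mulr1 fmorphV.
  by rewrite /coef2pi E [LHS]exprMn [(twopii^-1 * _) ^+ M]exprMn exprVn.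
rewrite cE -mulrA; congr (_ * _); rewrite /foxH /vlines_integral -mulrA; congr (_ * (_ * _)).
apply: eq_cintegral => t; rewrite /W /=.
rewrite cintegralZ; last by apply: cintegrable_dirichlet_kernel => m; exact: RE_line_gt0.
rewrite dirichlet_integral//.
rewrite -[RHS]/((Gamma (1 + 2^-1 * \sum_(m < M) line t m))^-1 * \prod_(m < M)
  (Gamma (alpha%:C - line t m) * Gamma (beta%:C - line t m) * Gamma (omega%:C - line t m)
   * Gamma (line t m / 2) / Gamma (omega%:C + 2^-1 - line t m)
   * cpow (kappa * Num.sqrt (thr / gbar)) (line t m))).
(* The power of [thr] from Dirichlet's formula splits over the variables and merges with the
   constants into the powers of the argument of [foxH]. *)
rewrite cpow_sum -mulr_suml [2^-1 * _]mulrC mulrA [LHS]mulrC; congr (_ * _).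
rewrite /weight -!big_split /=; apply: eq_bigr => m _.
by rewrite cpow_snr// /mellin_weight; ring.
Qed.

End OutageProbability.

Theorem proposition2 (R : realType) (M : nat)
    (alpha beta omega A0 hl gbar Rt : R) (sigmaG : R) (sigmaH : 'I_M -> R)
    (M_ge1 : (1 <= M)%N)
    (alpha_gt0 : 0 < alpha) (beta_gt0 : 0 < beta) (omega_gt0 : 0 < omega)
    (A0_gt0 : 0 < A0) (hl_gt0 : 0 < hl) (gbar_gt0 : 0 < gbar) (Rt_gt0 : 0 < Rt)
    (sigmaG_lt : sigmaG < Num.min alpha (Num.min beta omega))
    (sigmaH_in : forall m,
       0 < sigmaH m < Num.min alpha (Num.min beta omega)) :
  let c : R := expR 1 / (2 * pi) in
  let f : R -> R := snr_density sigmaG alpha beta omega A0 hl gbar in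
  let thr : R := (2 `^ (2 * Rt) - 1) / c in
  let u : R :=
    alpha * beta / (A0 * hl) * Num.sqrt ((2 `^ (2 * Rt) - 1) / (c * gbar)) in
  let Pout : \bar R :=
    joint_prob f [set x : M.-tuple (measurableTypeR R) |
      2^-1 * log2 (1 + c * \sum_(m < M) (tnth x m : R)) < Rt] in
  Pout = joint_prob f [set x : M.-tuple (measurableTypeR R) |
           \sum_(m < M) (tnth x m : R) <= thr] /\
  Pout \is a fin_num /\
  (fine Pout)%:C =
    ((Num.sqrt omega)%:C / (2 * Gamma alpha%:C * Gamma beta%:C)) ^+ M *
    foxH sigmaH alpha beta omega (fun=> u).
Proof.
move=> c f thr u Pout.
have c0 : 0 < c by rewrite divr_gt0 ?expR_gt0// mulr_gt0// pi_gt0.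
have ln20 : 0 < ln 2 :> R by rewrite ln_gt0// ltr1n.
have p1 : 1 < 2 `^ (2 * Rt) :> R.
  by rewrite /powR pnatr_eq0/= -[ltLHS]expR0 ltr_expR mulr_gt0// mulr_gt0.
have thr0 : 0 < thr by rewrite divr_gt0// subr_gt0.
have uE : u = alpha * beta / (A0 * hl) * Num.sqrt (thr / gbar).
  by rewrite /u /thr; congr (_ * Num.sqrt _); field; rewrite !gt_eqF.
(* Positivity of the coordinates makes the argument of the logarithm positive, so the comparison can
   be exponentiated; [joint_prob] only looks at such points. *)
have capacityE (x : M.-tuple (measurableTypeR R)) : positive_orthant x ->
    (2^-1 * log2 (1 + c * \sum_(m < M) (tnth x m : R)) < Rt) =
    (\sum_(m < M) (tnth x m : R) < thr).
  move=> xpos; set s := \sum_(m < M) _.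
  have s0 : 0 <= s by apply: sumr_ge0 => m _; exact: ltW (xpos m).
  have cs0 : 0 < 1 + c * s by rewrite ltr_pwDl// mulr_ge0// ltW.
  rewrite /log2 ltr_pdivrMl// ltr_pdivrMr// -ln_powR ltr_ln ?posrE ?powR_gt0//.
  by rewrite /thr ltr_pdivlMr// ltrBrDl [s * c]mulrC.
have PE : Pout = joint_prob f [set x : M.-tuple (measurableTypeR R) |
    \sum_(m < M) (tnth x m : R) < thr ?<= if false].
  apply: (congr1 (fun D => (\int[lebesgue_tuple M]_(x in D)
    (\prod_(m < M) f (tnth x m))%R%:E)%E)).
  by apply/seteqP; split => x /= [xpos xs]; split => //; move: xs;
    rewrite /= capacityE.
have [p [Ep Hp]] := joint_prob_foxH alpha_gt0 beta_gt0 A0_gt0 hl_gt0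
  gbar_gt0 sigmaG_lt sigmaH_in thr0 false.
have [q [Eq Hq]] := joint_prob_foxH alpha_gt0 beta_gt0 A0_gt0 hl_gt0
  gbar_gt0 sigmaG_lt sigmaH_in thr0 true.
(* Both probabilities equal the same value of [foxH], so the boundary of the simplex needs no
   separate measure-zero argument. *)
have pq : p = q by apply: complexI; rewrite Hp Hq.
rewrite PE uE Ep; split; last by split.
by rewrite pq -Eq.
Qed.
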